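(* Let $q, a \in \mathbb{N}$ be coprime. Then \[\limsup_{\substack{n\to\infty\\ n \in S_{q, a}}} \frac{n}{\varphi(n) (\log(\varphi(q)\log{n}))^{1/\varphi(q)}} = \frac{1}{C(q,a)}.\]
   Context: $\varphi$ is Euler's totient function and $\gamma$ is the Euler–Mascheroni constant. $S_{q,a} = \{n \in \mathbb{N} : \text{for every prime } p,\ p \mid n \implies p \equiv a \pmod q\}$. The positive constant $C(q,a)$ is the one in the asymptotic formula $\prod_{p \le x,\ p\equiv a \pmod q}(1-\frac1p) \sim C(q,a)/(\log x)^{1/\varphi(q)}$ as $x\to\infty$; explicitly $C(q, a)^{\varphi(q)} = e^{-\gamma} \prod_{p} \left(1 - \frac{1}{p}\right)^{\alpha(p; q, a)}$, the product being over all primes $p$ (in increasing order), where $\alpha(p;q,a)=\varphi(q)-1$ if $p\equiv a \pmod q$ and $\alpha(p;q,a)=-1$ otherwise. *)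

(* Defs.v *)
From mathcomp Require Import all_boot all_order all_algebra.
From mathcomp Require Import all_classical all_reals all_analysis.
Import Order.TTheory GRing.Theory Num.Theory.
Import numFieldNormedType.Exports.

Set Implicit Arguments.
Unset Strict Implicit.
Unset Printing Implicit Defensive.

Local Open Scope classical_set_scope.
Local Open Scope ring_scope.

Definition S_set (q a : nat) : set nat :=
  [set n | (0 < n)%N /\ forall p : nat, prime p -> (p %| n)%N -> p = a %[mod q]].

(* The range [p < truncn x + 1] is [p <= x] for a real [x >= 0]. *)
Definition mertens_prod (R : realType) (q a : nat) (x : R) : R :=
  \prod_(p < (Num.truncn x).+1 | prime p && (p == a %[mod q])) (1 - (p%:R)^-1).

(* The asymptotic formula determines [C]. That such a [C] exists for [0 < q] and
   coprime [q], [a] is Mertens' theorem for arithmetic progressions; it is not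
   assumed here, and [get] returns a default value if there is none. *)
Definition C_const (R : realType) (q a : nat) : R :=
  get [set C : R | 0 < C /\
    mertens_prod q a x / (C / (ln x) `^ (totient q)%:R^-1) @[x --> +oo] --> (1 : R)].

(* Main.v *)
Require Import Defs.
From mathcomp Require Import all_boot all_order all_algebra all_fingroup.
From mathcomp Require Import cyclic cyclotomic separable mxrepresentation complex.
From mathcomp Require Import all_classical all_reals all_analysis.
From mathcomp Require Import ring lra zify.
Import Order.TTheory GRing.Theory Num.Theory.
Import numFieldNormedType.Exports.

(* Everything rests on Mertens' theorem for arithmetic progressions, that is on
   sum_{p <= N, p = a mod q} ln p / p = ln N / phi(q) + O(1), which shows that C
   exists. By orthogonality of the characters modulo q this reduces to bounding
   M(N) = sum_{n <= N} chi(n) Lambda(n) / n for nonprincipal chi. Summing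
   ln = 1 * Lambda against chi(n) / n gives L(1, chi) M(N) = O(1), and if
   L(1, chi) = 0, Moebius inversion gives M(N) = - ln N + O(1). The latter is
   excluded by the 3-4-1 inequality when chi^2 is nonprincipal, and by Monsky's
   Lambert series argument when chi is real.

   Upper bound of the limsup: the primes above ln n change
   n / phi(n) = prod_{p | n} (1 - 1/p)^-1 by a factor tending to 1, and those
   below ln n contribute at most the Mertens product at ln n. Lower bound: take
   n = prod_{p <= X, p = a mod q} p, for which ln n <= 4 X by Chebyshev. *)

Set Implicit Arguments.
Unset Strict Implicit.
Unset Printing Implicit Defensive.
Local Open Scope classical_set_scope.
Local Open Scope ring_scope.

(** All estimates are finite and explicit: no complex variable s occurs, and L(1, chi) is only the
    limit of its partial sums. What makes this work is the rate O(1/N) of that convergence. In a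
    convolution 1 * G summed against chi(n) / n, the inner sum up to N / d is replaced by L(1, chi)
    at a cost O(d/N), which leaves a bounded error as soon as the sum of |G| up to N is O(N). When
    L(1, chi) = 0, the same rate is the input of the Lambert series argument. The existence of C
    asks for a limit, whereas the sums of ln p / p are only known up to O(1). Weighting by 1 / ln p
    repairs this: bounded partial sums against a decreasing weight converge. The factor phi(q)
    inside the logarithm is absorbed by ln (phi(q) y) ~ ln y. *)

Section DivisorSums.
Variable V : nmodType.
Implicit Types (F : nat -> V).

Lemma big_divisors n N F : (0 < n <= N)%N ->
  \sum_(d <- divisors n) F d = \sum_(1 <= d < N.+1 | (d %| n)%N) F d.
Proof.
move=> /andP[n0 nN]; rewrite -[RHS]big_filter; apply: perm_big.
apply: uniq_perm; rewrite ?divisors_uniq ?filter_uniq ?iota_uniq// => d.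
rewrite -dvdn_divisors// mem_filter mem_index_iota.
case: (boolP (d %| n)%N) => //= dn.
have := dvdn_leq n0 dn; have := dvdn_gt0 n0 dn; lia.
Qed.

(** Both sides run over the lattice points with [d * k <= N]. In the induction, [N %/ d] grows by
    one exactly at the divisors d of N + 1. *)
Lemma sum_divisors_hyperbola N (F : nat -> nat -> V) :
  \sum_(1 <= n < N.+1) \sum_(d <- divisors n) F d (n %/ d)%N =
  \sum_(1 <= d < N.+1) \sum_(1 <= k < (N %/ d).+1) F d k.
Proof.
elim: N => [|N IH]; first by rewrite !big_geq.
rewrite big_nat_recr//= IH [RHS]big_nat_recr//= divnn/= big_nat1.
rewrite (big_divisors (N := N.+1)) ?leqnn//.
rewrite [X in _ + X]big_mkcond [X in _ + X]big_nat_recr//= dvdnn divnn/= addrA.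
congr (_ + _); rewrite -big_split/=.
apply: eq_big_nat => d /andP[d0 dN].
rewrite divnS//; case: ifP => dvd /=; last by rewrite add0n addr0.
by rewrite dvd add1n [RHS]big_nat_recr.
Qed.

(** Both sides run over the pairs with [d * e] dividing n. This is the rearrangement behind Moebius
    inversion. *)
Lemma exchange_divisors n (F : nat -> nat -> V) : (0 < n)%N ->
  \sum_(d <- divisors n) \sum_(e <- divisors (n %/ d)) F d e =
  \sum_(e <- divisors n) \sum_(d <- divisors (n %/ e)) F d e.
Proof.
move=> n0.
have E (G : nat -> nat -> V) :
    \sum_(d <- divisors n) \sum_(e <- divisors (n %/ d)) G d e =
    \sum_(1 <= d < n.+1) \sum_(1 <= e < n.+1 | (d * e %| n)%N) G d e.
  rewrite (big_divisors (N := n)) ?n0 ?leqnn// big_mkcond/=.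
  apply: eq_big_nat => d /andP[d0 _]; case: ifP => dn.
    rewrite (big_divisors (N := n)); last first.
      by rewrite divn_gt0// dvdn_leq//= leq_div.
    by apply: eq_bigl => e; rewrite dvdn_divRL// mulnC.
  rewrite big_pred0// => e; apply: contraFF dn => de.
  exact: dvdn_trans (dvdn_mulr _ (dvdnn d)) de.
rewrite E [RHS](E (fun e d => F d e)) (exchange_big_dep xpredT)//=.
by apply: eq_bigr => e _; apply: eq_bigl => d; rewrite mulnC.
Qed.

Lemma big_divisors_mul p n F : (0 < p)%N -> (0 < n)%N ->
  \sum_(d <- divisors (p * n) | (p %| d)%N) F d =
  \sum_(e <- divisors n) F (p * e)%N.
Proof.
move=> p0 n0; rewrite -big_filter -(big_map (muln p) xpredT F); apply: perm_big.
apply: uniq_perm.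
- by rewrite filter_uniq// divisors_uniq.
- rewrite map_inj_uniq ?divisors_uniq// => x y /eqP.
  by rewrite eqn_mul2l eqn0Ngt p0 => /eqP.
move=> d; rewrite mem_filter -dvdn_divisors ?muln_gt0 ?p0//.
apply/andP/mapP => [[/dvdnP[e ->]]|[e]].
  by rewrite mulnC dvdn_pmul2l// => en; exists e; rewrite -?dvdn_divisors.
by rewrite -dvdn_divisors// => en ->; rewrite dvdn_mulr// dvdn_pmul2l.
Qed.

Lemma big_divisors_coprime p m n F : prime p -> (0 < n)%N ->
  n = (p * m)%N ->
  \sum_(d <- divisors n | ~~ (p %| d)%N) F d =
  \sum_(d <- divisors m | ~~ (p %| d)%N) F d.
Proof.
move=> pp n0 En.
have m0 : (0 < m)%N by move: n0; rewrite En; case: (m) => //; rewrite muln0.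
rewrite -big_filter -[RHS]big_filter; apply: perm_big.
apply: uniq_perm; rewrite ?filter_uniq ?divisors_uniq// => d.
rewrite !mem_filter -!dvdn_divisors//; case: (boolP (p %| d)%N) => //= pd.
by rewrite En Gauss_dvdr// coprime_sym prime_coprime.
Qed.

End DivisorSums.

(** * The Moebius function *)

Section Moebius.

Definition moebius_factor (k : nat) : int :=
  if k is k'.+1 then (if k' is 0 then -1 else 0) else 1.

Definition moebius (n : nat) : int :=
  \prod_(1 <= p < n.+1 | prime p) moebius_factor (logn p n).

(** The added primes exceed n and have exponent 0. A common range of primes is what allows
    [moebius (p * n)] to be compared with [moebius n]. *)
Lemma moebiusE n N : (0 < n <= N)%N ->
  moebius n = \prod_(1 <= p < N.+1 | prime p) moebius_factor (logn p n).
Proof.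
move=> /andP[n0 nN]; rewrite /moebius.
rewrite [RHS](big_cat_nat (n := n.+1))//=.
rewrite [X in _ = _ * X]big_nat_cond [X in _ = _ * X]big1 ?mulr1//.
move=> p /andP[/andP[np _] pp]; rewrite (_ : logn p n = 0%N)//.
by apply/eqP; rewrite eqn0Ngt logn_gt0 mem_primes pp n0/= gtnNdvd.
Qed.

Lemma moebius1 : moebius 1 = 1.
Proof. by rewrite /moebius big_mkcond big_nat1. Qed.

Lemma norm_moebius n : `|moebius n| <= 1.
Proof.
rewrite /moebius; apply: (big_ind (fun x : int => `|x| <= 1)) => // [x y hx hy|p _].
  by rewrite normrM mulr_ile1.
by case: (logn p n) => [|[|k]].
Qed.

Lemma moebius_prime_mul p n : prime p -> (0 < n)%N ->
  moebius (p * n) = if (p %| n)%N then 0 else - moebius n.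
Proof.
move=> pp n0; have p0 := prime_gt0 pp.
have pn : (p <= p * n)%N by rewrite leq_pmulr.
rewrite (@moebiusE n (p * n)) ?n0 ?leq_pmull// /moebius.
have D1 (G : nat -> int) : \prod_(1 <= i < (p * n).+1 | prime i) G i =
    G p * \prod_(1 <= i < (p * n).+1 | prime i && (i != p)) G i.
  rewrite -big_filter (bigD1_seq p) ?filter_uniq ?iota_uniq//= ?big_filter_cond//.
  by rewrite mem_filter pp mem_index_iota p0 ltnS.
rewrite !D1.
rewrite lognM// logn_prime// eqxx add1n.
have -> : \prod_(1 <= i < (p * n).+1 | prime i && (i != p))
     moebius_factor (logn i (p * n)) =
   \prod_(1 <= i < (p * n).+1 | prime i && (i != p)) moebius_factor (logn i n).
  apply: eq_bigr => i /andP[pi /negbTE ip].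
  by rewrite lognM// logn_prime// ip add0n.
have := logn_gt0 p n; rewrite mem_primes pp n0/= => <-.
by case: (logn p n) => [|k] /=; rewrite ?mul0r// mulN1r mul1r.
Qed.

(** Write n = p m with p prime. A divisor p e with e dividing m contributes [- moebius e] if p does
    not divide e and 0 otherwise, which cancels the divisors prime to p. *)
Lemma sum_moebius n : (0 < n)%N ->
  \sum_(d <- divisors n) moebius d = (n == 1%N)%:R.
Proof.
move=> n0; case: eqP => [->|/eqP n1].
  by rewrite (big_divisors (N := 1))// big_mkcond big_nat1 dvdnn moebius1.
have pp : prime (pdiv n) by rewrite pdiv_prime// ltn_neqAle eq_sym n1.
set p := pdiv n in pp.
have [m Em] : exists m, n = (p * m)%N.
  by have /dvdnP[m ->] := pdiv_dvd n; exists m; rewrite mulnC.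
have m0 : (0 < m)%N by move: n0; rewrite Em; case: (m) => //; rewrite muln0.
rewrite (bigID (fun d => p %| d)%N)/= (big_divisors_coprime _ pp n0 Em).
rewrite [X in divisors X]Em big_divisors_mul ?(prime_gt0 pp)//.
rewrite [X in _ + X]big_mkcond/= -big_split/= big_seq big1// => d.
rewrite -dvdn_divisors// => /(dvdn_gt0 m0) d0.
by rewrite moebius_prime_mul//; case: ifP => _; rewrite ?addr0// addNr.
Qed.

End Moebius.

(** * The von Mangoldt function and Chebyshev's bound *)

Section Chebyshev.
Variable R : realType.
Local Notation lnn n := (ln (n%:R : R)).

Lemma lnn_ge0 n : 0 <= lnn n.
Proof. by case: n => [|n]; [rewrite ln0|rewrite ln_ge0// ler1n]. Qed.

Lemma lnnM m n : (0 < m)%N -> (0 < n)%N -> lnn (m * n) = lnn m + lnn n.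
Proof. by move=> m0 n0; rewrite natrM lnM// posrE ltr0n. Qed.

Lemma ln_prod (I : Type) (r : seq I) (P : pred I) (F : I -> R) :
  (forall i, P i -> 0 < F i) ->
  ln (\prod_(i <- r | P i) F i) = \sum_(i <- r | P i) ln (F i).
Proof.
move=> F0.
suff [] : 0 < \prod_(i <- r | P i) F i /\
  ln (\prod_(i <- r | P i) F i) = \sum_(i <- r | P i) ln (F i) by [].
apply: (big_rec2 (fun x y => 0 < x /\ ln x = y)); first by rewrite ln1.
move=> i y x Pi [x0 <-]; split; first by rewrite mulr_gt0 ?F0.
by rewrite lnM// posrE F0.
Qed.

Lemma ln_succ_sub n : (0 < n)%N -> 0 <= lnn n.+1 - lnn n <= n%:R^-1.
Proof.
move=> n0; have n0' : (0 : R) < n%:R by rewrite ltr0n.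
rewrite subr_ge0 ler_ln ?posrE ?ltr0n// ler_nat leqnSn/=.
rewrite -ln_div ?posrE ?ltr0n//.
have -> : n.+1%:R / n%:R = 1 + n%:R^-1 :> R.
  by rewrite -natr1; field; rewrite gt_eqF.
by apply: le_ln1Dx; rewrite (lt_trans _ (_ : 0 < _))// ?ltrN10// invr_gt0.
Qed.

(** Encoded as a sum over all pairs with p^k = n, of which at most one exists, so that weighted sums
    over n become sums over prime powers by exchanging summations. *)
Definition mangoldt n : R :=
  \sum_(1 <= p < n.+1 | prime p) \sum_(1 <= k < n.+1 | (p ^ k == n)%N) lnn p.

Lemma mangoldt_ge0 n : 0 <= mangoldt n.
Proof. by do 2!(apply: sumr_ge0 => ? _); exact: lnn_ge0. Qed.

Lemma mangoldtE n N : (0 < n <= N)%N -> mangoldt n =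
  \sum_(1 <= p < N.+1 | prime p) \sum_(1 <= k < N.+1 | (p ^ k == n)%N) lnn p.
Proof.
move=> /andP[n0 nN]; rewrite [RHS](big_cat_nat (n := n.+1))//=.
rewrite [X in _ = _ + X]big_nat_cond [X in _ = _ + X]big1 ?addr0; last first.
  move=> p /andP[/andP[np _] pp]; rewrite big_nat_cond big1// => k.
  move=> /andP[/andP[k0 _] /eqP pkn].
  have : (p <= p ^ k)%N by rewrite -{1}(expn1 p) leq_pexp2l// prime_gt0.
  by rewrite pkn leqNgt np.
apply: eq_bigr => p pp; rewrite [RHS](big_cat_nat (n := n.+1))//=.
rewrite [X in _ = _ + X]big_nat_cond [X in _ = _ + X]big1 ?addr0//.
move=> k /andP[/andP[nk _] /eqP pkn].
have := ltn_expl k (prime_gt1 pp); rewrite pkn; lia.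
Qed.

Lemma sum_mangoldt_weight (G : nat -> R) N :
  \sum_(1 <= n < N.+1) G n * mangoldt n =
  \sum_(1 <= p < N.+1 | prime p) \sum_(1 <= k < N.+1 | (p ^ k <= N)%N)
    G (p ^ k)%N * lnn p.
Proof.
transitivity (\sum_(1 <= n < N.+1) \sum_(1 <= p < N.+1 | prime p)
    \sum_(1 <= k < N.+1) if (p ^ k == n)%N then G n * lnn p else 0).
  apply: eq_big_nat => n nN; rewrite (@mangoldtE n N)// mulr_sumr.
  by apply: eq_bigr => p _; rewrite mulr_sumr -big_mkcond.
rewrite exchange_big/=; apply: eq_bigr => p pp.
rewrite exchange_big/= [RHS]big_mkcond/=; apply: eq_bigr => k _.
rewrite -big_mkcond/= (eq_bigl (fun n => n == p ^ k)%N); last first.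
  by move=> n; rewrite eq_sym.
by rewrite big_nat1_eq ltnS expn_gt0 prime_gt0.
Qed.

(** A prime p contributes ln p once for every k >= 1 with p^k dividing n, hence [logn p n] times, as
    in the logarithm of the factorization of n. *)
Lemma sum_mangoldt n : (0 < n)%N -> \sum_(d <- divisors n) mangoldt d = lnn n.
Proof.
move=> n0; rewrite (big_divisors (N := n)) ?n0 ?leqnn//.
transitivity (\sum_(1 <= d < n.+1) (d %| n)%:R * mangoldt d).
  by rewrite big_mkcond; apply: eq_bigr => d _; case: ifP; rewrite ?mul1r ?mul0r.
rewrite sum_mangoldt_weight.
rewrite -[in RHS](partnT n0) /partn natr_prod ln_prod; last first.
  move=> p _; case: p => [|p]; first by rewrite lognE.
  by rewrite ltr0n expn_gt0.
rewrite big_nat_recl// lognE/= ln1 add0r.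
rewrite -(big_add1 _ _ 0 n.+1 xpredT (fun p => lnn (p ^ logn p n)))/=.
rewrite big_mkcond/=; apply: eq_big_nat => p /andP[p0 pn]; case: ifP => pp; last first.
  by rewrite lognE pp/= expn0 ln1.
rewrite natrX lnXn ?ltr0n// logn_count_dvd// -[RHS]mulr_natl natr_sum mulr_suml.
rewrite big_mkcond/= (eq_bigr (fun k => (p ^ k %| n)%:R * lnn p)); last first.
  move=> k _; case: leqP => // nk; rewrite (_ : (p ^ k %| n)%N = false) ?mul0r//.
  by rewrite gtnNdvd.
rewrite big_nat_recr//= (_ : (p ^ n %| n)%N = false) ?mul0r ?addr0//.
by rewrite gtnNdvd// ltn_expl// prime_gt1.
Qed.

(** A crude Stirling formula for ln (N!), by induction from 0 <= N (ln (N + 1) - ln N) <= 1. *)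
Lemma lnn_fact_bounds N :
  N%:R * lnn N - N%:R <= \sum_(1 <= n < N.+1) lnn n <= N%:R * lnn N.
Proof.
elim: N => [|N /andP[IH1 IH2]].
  by rewrite big_geq// mul0r subr0 lexx.
rewrite big_nat_recr//=.
have [->|N0] := posnP N; first by rewrite big_geq// ln1; lra.
have /andP[h1 h2] := ln_succ_sub N0.
have N0' : (0 : R) < N%:R by rewrite ltr0n.
have h3 : N%:R * (lnn N.+1 - lnn N) <= 1.
  by rewrite mulrC -ler_pdivlMr// mul1r.
have h4 : 0 <= N%:R * (lnn N.+1 - lnn N) by rewrite mulr_ge0// ltW.
rewrite -natr1; move: h3 h4 IH1 IH2; rewrite -natr1.
set a := ln _; set b := ln _; set c := \sum_(1 <= i < _) _.
move=> *; apply/andP; split; nra.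
Qed.

Lemma sum_mangoldt_floor N :
  \sum_(1 <= n < N.+1) mangoldt n * (N %/ n)%:R = \sum_(1 <= n < N.+1) lnn n.
Proof.
transitivity (\sum_(1 <= n < N.+1) \sum_(d <- divisors n) mangoldt d).
  rewrite (sum_divisors_hyperbola N (fun d _ => mangoldt d)).
  by apply: eq_bigr => n _; rewrite sumr_const_nat subn1 mulr_natr.
by apply: eq_big_nat => n /andP[n0 _]; rewrite sum_mangoldt.
Qed.

(** The left side is the logarithm of the central binomial coefficient; each step adds at most 2 ln
    2 <= 2. *)
Lemma lnn_fact_double m :
  \sum_(1 <= n < (m.*2).+1) lnn n - 2 * \sum_(1 <= n < m.+1) lnn n
  <= 2 * m%:R.
Proof.
elim: m => [|m IH]; first by rewrite !big_geq// !mulr0 subr0.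
rewrite doubleS (big_nat_recr m.+1)//= (big_nat_recr (m.*2).+2)//= (big_nat_recr (m.*2).+1)//=.
have h1 : lnn (m.*2).+1 <= lnn (m.*2).+2 by rewrite ler_ln ?posrE ?ltr0n// ler_nat.
have h2 : lnn (m.*2).+2 = lnn 2 + lnn m.+1.
  by rewrite -lnnM// -doubleS mul2n.
have h3 : lnn 2 <= 1.
  by have := @le_ln1Dx R 1; rewrite -[1 + 1]/(2%:R); apply; lra.
rewrite -[m.+1%:R in leRHS]natr1; lra.
Qed.

Definition psi N : R := \sum_(1 <= n < N.+1) mangoldt n.

Lemma psi_mono : {homo psi : m n / (m <= n)%N >-> m <= n}.
Proof.
move=> m n mn; rewrite /psi [leRHS](big_cat_nat (n := m.+1))//=.
by rewrite lerDl sumr_ge0// => *; exact: mangoldt_ge0.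
Qed.

(** In ln ((2m)!) - 2 ln (m!), [mangoldt n] has the coefficient floor(2m/n) - 2 floor(m/n), which is
    nonnegative, and at least 1 for m < n <= 2m. *)
Lemma psi_double m : psi m.*2 - psi m <= 2 * m%:R.
Proof.
apply: le_trans (lnn_fact_double m).
rewrite -!sum_mangoldt_floor /psi.
have mm : (m <= m.*2)%N by rewrite -addnn leq_addr.
have E : \sum_(1 <= n < m.+1) mangoldt n * (m %/ n)%:R =
         \sum_(1 <= n < (m.*2).+1) mangoldt n * (m %/ n)%:R.
  rewrite [RHS](big_cat_nat (n := m.+1))//=.
  rewrite [X in _ = _ + X]big_nat [X in _ = _ + X]big1 ?addr0// => n /andP[mn _].
  by rewrite divn_small// mulr0.
rewrite E mulr_sumr -sumrB [X in X - _ <= _](big_cat_nat (n := m.+1))//=.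
rewrite [leLHS]addrC addKr.
rewrite [leRHS](big_cat_nat (n := m.+1))//=.
rewrite -[leLHS]add0r; apply: lerD.
  rewrite big_nat; apply: sumr_ge0 => n /andP[n0 _].
  rewrite mulrCA -mulrBr mulr_ge0 ?mangoldt_ge0// subr_ge0 -natrM ler_nat.
  by rewrite leq_divRL// -mulnA -[leqRHS]mul2n leq_mul2l leq_divM.
rewrite big_nat [leRHS]big_nat; apply: ler_sum => n /andP[mn n2].
rewrite [(m %/ n)%N]divn_small// mulr0 mulr0 subr0 ler_peMr ?mangoldt_ge0//.
by rewrite ler1n divn_gt0 //; lia.
Qed.

(** Halving N gives a geometric series; the slack in the constant 4 absorbs the rounding. For N = 2m
    + 1, the bound 6 (m + 1) obtained at 2 (m + 1) is at most 4 N once m >= 1. *)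
Lemma psi_le N : psi N <= 4 * N%:R.
Proof.
elim/ltn_ind: N => N IH; have [->|N0] := posnP N; first by rewrite /psi big_geq// mulr0.
have [->|N1] := eqVneq N 1%N.
  rewrite /psi big_nat1 /mangoldt big_mkcond big_nat1/=; lra.
have EN := odd_double_half N; case: (boolP (odd N)) EN => oN EN.
  have m0 : (0 < N./2)%N by lia.
  have h1 := IH (N./2).+1 ltac:(lia).
  have h2 := psi_double (N./2).+1.
  have h3 : psi N <= psi (N./2).+1.*2 by apply: psi_mono; lia.
  have h4 : (1 : R) <= (N./2)%:R by rewrite ler1n.
  have h5 : N%:R = 1 + 2 * (N./2)%:R :> R by rewrite -{1}EN -muln2 natrD natrM /=; ring.
  rewrite h5; move: h1 h2; rewrite -natr1; lra.
have h1 := IH (N./2) ltac:(lia).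
have h2 := psi_double (N./2).
have h4 : (0 : R) <= (N./2)%:R by [].
have h5 : N%:R = 2 * (N./2)%:R :> R by rewrite -{1}EN -muln2 natrD natrM /=; ring.
move: h2; rewrite add0n in EN; rewrite EN h5; lra.
Qed.

(** Replacing floor(N/n) by N/n in the formula for ln (N!) costs at most psi N <= 4 N; dividing by N
    gives the bound. *)
Lemma mertens_mangoldt N : (0 < N)%N ->
  `|\sum_(1 <= n < N.+1) n%:R^-1 * mangoldt n - lnn N| <= 4.
Proof.
move=> N0; have N0' : (0 : R) < N%:R by rewrite ltr0n.
have /andP[h1 h2] := lnn_fact_bounds N.
have h3 := psi_le N; set S := \sum_(_ <= _ < _) _.
have : 0 <= N%:R * S - \sum_(1 <= n < N.+1) lnn n <= psi N.
  rewrite -sum_mangoldt_floor /S mulr_sumr -sumrB.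
  rewrite big_nat sumr_ge0/=; last first.
    move=> n /andP[n0 _]; rewrite mulrA mulrC -mulrBr mulr_ge0 ?mangoldt_ge0//.
    rewrite subr_ge0 ler_pdivlMr ?ltr0n// -natrM ler_nat.
    exact: leq_divM.
  rewrite /psi [leRHS]big_nat; apply: ler_sum => n /andP[n0 _].
  rewrite mulrA mulrC -mulrBr ler_piMr ?mangoldt_ge0// lerBlDr.
  rewrite ler_pdivrMr ?ltr0n// nat1r -natrM ler_nat.
  by rewrite ltnW// ltn_ceil.
move=> /andP[h4 h5].
have E : S - lnn N = N%:R^-1 * (N%:R * S - N%:R * lnn N).
  by rewrite -mulrBr mulKf// gt_eqF.
rewrite E normrM gtr0_norm ?invr_gt0// mulrC ler_pdivrMr//.
rewrite ler_norml; lra.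
Qed.
End Chebyshev.

(** * From prime powers to primes *)

Section PrimeSums.
Variable R : realType.
Local Notation lnn n := (ln (n%:R : R)).

Lemma sum_geometric_le (x : R) M : 0 <= x < 1 ->
  \sum_(2 <= k < M.+2) x ^+ k <= x ^+ 2 / (1 - x).
Proof.
move=> /andP[x0 x1]; rewrite ler_pdivlMr ?subr_gt0//.
suff -> : (\sum_(2 <= k < M.+2) x ^+ k) * (1 - x) = x ^+ 2 - x ^+ M.+2.
  by rewrite gerBl exprn_ge0.
elim: M => [|M IH]; first by rewrite big_geq// mul0r subrr.
by rewrite big_nat_recr//= mulrDl IH !exprS; ring.
Qed.

(** The sequence (ln N + 2) / N imitates (ln x + 1) / x, whose derivative is - ln x / x^2. The
    constant is 2 because (n + 1) ln ((n + 1) / n) exceeds 1 but not 2. *)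
Lemma sum_ln_telescope N : (0 < N)%N ->
  \sum_(2 <= n < N.+1) lnn n / (n%:R * (n%:R - 1)) <= 2 - (lnn N + 2) / N%:R.
Proof.
elim: N => // -[_ _|N IH _]; first by rewrite big_geq// ln1 divr1 add0r subrr.
rewrite big_nat_recr//=; apply: le_trans (lerD (IH _) (lexx _)) _ => //.
have /andP[_ h] := ln_succ_sub R (ltn0Sn N).
have n0 : (0 : R) < N.+1%:R by rewrite ltr0n.
have n1 : (1 : R) <= N.+1%:R by rewrite ler1n.
rewrite -[N.+2%:R]natr1 addrK; set n := N.+1%:R in h n0 n1 *.
rewrite -[N.+2%:R]natr1 -/n in h.
set a := ln (n + 1) in h *; set b := ln n in h *.
have h2 : n * (a - b) <= 1 by rewrite mulrC -ler_pdivlMr// mul1r.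
have -> : 2 - (b + 2) / n + a / ((n + 1) * n) =
   2 - (a + 2) / (n + 1) - (2 + (n + 1) * b - n * a - a) / (n * (n + 1)).
  by field; rewrite !gt_eqF//; lra.
rewrite gerBl divr_ge0//; nra.
Qed.

(** The proper powers of p contribute at most ln p / (p (p - 1)) by the geometric series, and these
    bounds sum to at most 2. *)
Lemma mangoldt_primes (f : nat -> R) N : (forall n, `|f n| <= 1) ->
  `|\sum_(1 <= n < N.+1) f n / n%:R * mangoldt R n -
    \sum_(1 <= p < N.+1 | prime p) f p * (lnn p / p%:R)| <= 2.
Proof.
move=> f1; rewrite (sum_mangoldt_weight (fun n => f n / n%:R)) -sumrB.
have [->|N0] := posnP N; first by rewrite big_geq// normr0.
apply: le_trans (ler_norm_sum _ _ _) _.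
apply: (@le_trans _ _ (\sum_(2 <= n < N.+1) lnn n / (n%:R * (n%:R - 1)))); last first.
  apply: le_trans (sum_ln_telescope N0) _.
  by rewrite gerBl divr_ge0 ?addr_ge0 ?lnn_ge0.
rewrite big_ltn_cond//= big_mkcond/= big_nat [leRHS]big_nat; apply: ler_sum.
move=> p /andP[p1 pN]; have p0 : (0 < p)%N by lia.
have p1' : (1 : R) < p%:R by rewrite ltr1n.
have T0 : 0 <= lnn p / (p%:R * (p%:R - 1)).
  by rewrite divr_ge0 ?lnn_ge0// mulr_ge0// subr_ge0 ltW.
case: ifP => // pp.
rewrite big_ltn_cond//= expn1 -ltnS pN mulrA [_ * lnn p / _]mulrAC.
rewrite [X in `|X|]addrC addKr.
apply: le_trans (ler_norm_sum _ _ _) _; rewrite big_mkcond/=.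
apply: (@le_trans _ _ (\sum_(2 <= k < N.-1.+2) p%:R^-1 ^+ k * lnn p)).
  rewrite prednK//; apply: ler_sum => k _; case: ifP => _; last first.
    by rewrite mulr_ge0 ?lnn_ge0// exprn_ge0// invr_ge0.
  rewrite !normrM (ger0_norm (lnn_ge0 _ _)) ler_wpM2r ?lnn_ge0//.
  by rewrite natrX normfV normrX normr_nat exprVn ler_piMl// invr_ge0 exprn_ge0.
rewrite -mulr_suml mulrC ler_wpM2l ?lnn_ge0//.
apply: le_trans (sum_geometric_le _ _) _.
  by rewrite invr_ge0 ler0n/= invf_lt1// (lt_trans ltr01).
rewrite le_eqVlt; apply/orP; left; apply/eqP; field.
by rewrite !gt_eqF// ?subr_gt0// ?(lt_trans ltr01).
Qed.

End PrimeSums.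

(** * Abel summation and Dirichlet's test *)

Section DirichletTest.
Variable R : realType.
Implicit Types (u v : nat -> R) (B : R).

Lemma abel_summation u v m n : (m <= n)%N ->
  \sum_(m <= i < n) u i * v i =
  \sum_(m <= i < n) (\sum_(m <= j < i.+1) u j) * (v i - v i.+1) +
  (\sum_(m <= j < n) u j) * v n.
Proof.
elim: n => [|n IH]; first by rewrite leqn0 => /eqP ->; rewrite !big_geq// mul0r addr0.
rewrite leq_eqVlt => /predU1P[->|mn]; first by rewrite !big_geq// mul0r addr0.
by rewrite ltnS in mn; rewrite !big_nat_recr//= IH//; ring.
Qed.

Lemma abel_bound u v B m n : (m <= n)%N ->
  (forall k, `|\sum_(m <= i < k) u i| <= B) ->
  (forall i, (m <= i)%N -> v i.+1 <= v i) ->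
  (forall i, (m <= i)%N -> 0 <= v i) ->
  `|\sum_(m <= i < n) u i * v i| <= B * v m.
Proof.
move=> mn uB dv v0; rewrite abel_summation//.
have T : \sum_(m <= i < n) (v i - v i.+1) = v m - v n.
  by rewrite -opprB -telescope_sumr// -sumrN; apply: eq_bigr => i _; rewrite opprB.
apply: le_trans (ler_normD _ _) _.
have -> : B * v m = \sum_(m <= i < n) B * (v i - v i.+1) + B * v n.
  by rewrite -mulr_sumr T -mulrDr subrK.
apply: lerD; last by rewrite normrM (ger0_norm (v0 _ mn)) ler_wpM2r// v0.
apply: le_trans (ler_norm_sum _ _ _) _; rewrite big_nat [leRHS]big_nat.
apply: ler_sum => i /andP[mi _]; rewrite normrM (@ger0_norm _ (v i - _)).
  by rewrite ler_wpM2r// subr_ge0 dv.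
by rewrite subr_ge0 dv.
Qed.

(* The intervals of radius [B * v n] around the partial sums are nested, so
   they meet, and [v --> 0] is not needed. *)
Lemma dirichlet_test u v B a :
  (forall m k, `|\sum_(m <= i < k) u i| <= B) ->
  (forall i, (a <= i)%N -> v i.+1 <= v i) ->
  (forall i, (a <= i)%N -> 0 <= v i) ->
  exists L, forall n, (a <= n)%N ->
    `|\sum_(a <= i < n) u i * v i - L| <= B * v n.
Proof.
move=> uB dv v0; pose s n := \sum_(a <= i < n) u i * v i.
have B0 : 0 <= B by apply: le_trans (uB 0%N 0%N).
have sB m n : (a <= m)%N -> (m <= n)%N -> `|s n - s m| <= B * v m.
  move=> am mn; rewrite /s [X in X - _](big_cat_nat (n := m))//=.
  rewrite [X in `|X|]addrC addKr.
  by apply: abel_bound => // i mi; [apply: dv|apply: v0]; apply: leq_trans mi.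
have vm m n : (a <= m)%N -> (m <= n)%N -> v n <= v m.
  move=> am; elim: n => [|n IH]; first by rewrite leqn0 => /eqP ->.
  rewrite leq_eqVlt => /predU1P[->//|mn]; rewrite ltnS in mn.
  by apply: le_trans (IH mn); apply: dv; apply: leq_trans mn.
pose E := [set s n - B * v n | n in [set n | (a <= n)%N]].
have ubE m : (a <= m)%N -> ubound E (s m + B * v m).
  move=> am _ [n /= an <-]; have Bm := mulr_ge0 B0 (v0 _ am).
  have Bn := mulr_ge0 B0 (v0 _ an).
  case: (leqP m n) => [mn|/ltnW nm].
    by move: (sB _ _ am mn); rewrite ler_norml => /andP[_ h]; lra.
  by move: (sB _ _ an nm); rewrite ler_norml => /andP[h _]; lra.
have E0 : E !=set0 by exists (s a - B * v a); exists a => /=.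
exists (sup E) => n an; rewrite -/(s n) ler_norml; apply/andP; split.
  have := ge_sup E0 (ubE _ an); lra.
have : s n - B * v n <= sup E.
  by apply: ub_le_sup; [exists (s a + B * v a); exact: ubE|exists n].
lra.
Qed.

End DirichletTest.

(** * Characters of finite abelian groups *)

Section AbelianCharacters.
Variables (C : numClosedFieldType) (gT : finGroupType).
Local Notation rho := (regular_repr C [set: gT]%G).

(** Translation by x fixes a group element only if x = 1, so otherwise the permutation matrix has a
    zero diagonal. *)
Lemma regular_mx_trace (x : gT) : \tr (rho x) = (#|gT| * (x == 1%g))%:R.
Proof.
rewrite /mxtrace /= (eq_bigr (fun=> (x == 1%g)%:R)); last first.
  move=> i _; rewrite /regular_mx !mxE eqxx/=; congr (_%:R); congr nat_of_bool.
  rewrite -(inj_eq enum_val_inj) gring_indexK ?inE// eq_sym.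
  by rewrite -[X in _ == X]mulg1 (inj_eq (mulgI _)).
by rewrite sumr_const card_ord /gcard cardsT mulnC natrM mulr_natr.
Qed.

(** A is annihilated by X^k - 1, which is split and separable over C. *)
Lemma diagonalizable_finite_order n (A : 'M[C]_n) k : (0 < k)%N ->
  iter k (mulmx A) 1%:M = 1%:M -> exists2 P, P \in unitmx & similar_diag P A.
Proof.
case: n A => [A _ _|n A k0 Ak]; first by exists 1%:M; [rewrite unitmx1|apply/is_diag_mxP => -[]].
have [rs Ers] := closed_field_poly_normal ('X^k - 1 : {poly C}).
rewrite lead_coefXnsubC// scale1r in Ers.
apply/diagonalizableP; exists rs.
  rewrite -separable_prod_XsubC -Ers separable_Xn_sub_1//.
  by rewrite pnatr_eq0 -lt0n.
rewrite -Ers mxminpoly_min// rmorphB/= rmorphXn/= horner_mx_X rmorph1.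
suff -> : A ^+ k = 1 by rewrite subrr.
rewrite -[RHS]Ak; elim: (k) => //= m <-; exact: exprS.
Qed.

(* Diagonalize the regular representation; its trace is the orthogonality
   relation. *)
Lemma abelian_characters : abelian [set: gT]%SET ->
  exists X : 'I_#|gT| -> gT -> C,
    [/\ forall i, X i 1%g = 1,
        forall i x y, X i (x * y)%g = X i x * X i y
      & forall x, \sum_i X i x = (#|gT| * (x == 1%g))%:R].
Proof.
move=> abG.
have [P uP diagP] : exists2 P, P \in unitmx &
    all [pred A | similar_diag P A] [seq rho x | x <- enum gT].
  apply/codiagonalizableP; split.
    move=> _ _ /mapP[x _ ->] /mapP[y _ ->].
    rewrite /comm_mx -!repr_mxM ?inE//; congr (rho _).
    by have /centsP := abG; apply; rewrite inE.
  move=> _ /mapP[x _ ->]; apply: (@diagonalizable_finite_order _ _ #|gT|).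
    by apply/card_gt0P; exists 1%g.
  have E k : iter k (mulmx (rho x)) 1%:M = rho (x ^+ k)%g.
    elim: k => [|k /= ->]; first by rewrite expg0 repr_mx1.
    by rewrite -repr_mxM ?inE// expgS.
  by rewrite E -cardsT expg_cardG ?inE// repr_mx1.
pose D x := conjmx P (rho x).
have DE x : D x = P *m rho x *m invmx P by rewrite /D conjumx.
have D1 : D 1%g = 1%:M by rewrite DE repr_mx1 mulmx1 mulmxV.
have DM x y : D (x * y)%g = D x *m D y.
  by rewrite !DE repr_mxM ?inE// !mulmxA mulmxKV.
have Ddiag x i j : i != j -> D x i j = 0.
  move: diagP => /allP/(_ (rho x)); rewrite map_f ?mem_enum// => /(_ isT)/=.
  by move=> /is_diag_mxP; apply.
have cG : #|gT| = gcard [set: gT]%G by rewrite /gcard cardsT.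
(* Diagonal matrices multiply entrywise, so each position on the diagonal gives a character, and the
   sum over the positions is the trace. *)
exists (fun i x => D x (cast_ord cG i) (cast_ord cG i)); split.
- by move=> i; rewrite D1 mxE eqxx.
- move=> i x y; rewrite DM mxE (bigD1 (cast_ord cG i))//= big1 ?addr0// => j ji.
  by rewrite Ddiag ?mul0r// eq_sym.
move=> x; rewrite -regular_mx_trace.
rewrite -[RHS](_ : \tr (D x) = _); last by rewrite DE -mulmxA mxtrace_mulC mulmxKV.
rewrite /mxtrace [RHS](reindex (cast_ord cG))//.
by exists (cast_ord (esym cG)) => j _; rewrite ?cast_ordK ?cast_ordKV.
Qed.

End AbelianCharacters.

(** * Real-valued modulus, real and imaginary parts *)

Section Complex.
Local Open Scope complex_scope.
Variable R : realType.
Local Notation normc := (@Normc.normc R).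
Local Notation Re := (@complex.Re R).
Local Notation Im := (@complex.Im R).
Implicit Types z : R[i].

Lemma normcD z1 z2 : normc (z1 + z2) <= normc z1 + normc z2.
Proof. exact: le_normcD. Qed.

Lemma normc_ge0 z : 0 <= normc z.
Proof. by case: z => a b; apply: sqrtr_ge0. Qed.

Lemma normc_sum (I : Type) (r : seq I) (P : pred I) (F : I -> R[i]) :
  normc (\sum_(i <- r | P i) F i) <= \sum_(i <- r | P i) normc (F i).
Proof.
apply: (big_rec2 (fun x y => normc x <= y)); first by rewrite Normc.normc0.
by move=> i x y _ h; apply: le_trans (normcD _ _) _; rewrite lerD2l.
Qed.

Lemma normcR (x : R) : normc x%:C = `|x|.
Proof. by rewrite /= expr0n addr0 sqrtr_sqr. Qed.

Lemma normcX z n : normc (z ^+ n) = normc z ^+ n.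
Proof. by elim: n => [|n IH]; rewrite ?Normc.normc1// !exprS Normc.normcM IH. Qed.

Lemma Re_le_normc z : `|Re z| <= normc z.
Proof.
case: z => a b /=; rewrite -sqrtr_sqr ler_wsqrtr// lerDl sqr_ge0//.
Qed.

Lemma Im_le_normc z : `|Im z| <= normc z.
Proof.
case: z => a b /=; rewrite -sqrtr_sqr ler_wsqrtr// lerDr sqr_ge0//.
Qed.

Lemma normc_le_ReIm z : normc z <= `|Re z| + `|Im z|.
Proof.
case: z => a b /=; rewrite -[leRHS]ger0_norm ?addr_ge0// -sqrtr_sqr.
rewrite ler_wsqrtr// sqrrD !real_normK ?num_real// -addrA lerD2l lerDr.
by rewrite mulrn_wge0// mulr_ge0.
Qed.

Lemma Re_sum (I : Type) (r : seq I) (P : pred I) (F : I -> R[i]) :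
  Re (\sum_(i <- r | P i) F i) = \sum_(i <- r | P i) Re (F i).
Proof. by apply: (big_morph Re) => // -[a b] [c d]. Qed.

Lemma Im_sum (I : Type) (r : seq I) (P : pred I) (F : I -> R[i]) :
  Im (\sum_(i <- r | P i) F i) = \sum_(i <- r | P i) Im (F i).
Proof. by apply: (big_morph Im) => // -[a b] [c d]. Qed.

Lemma Re_scale z (x : R) : Re (z * x%:C) = Re z * x.
Proof. by case: z => a b /=; rewrite mulr0 subr0. Qed.

Lemma Im_scale z (x : R) : Im (z * x%:C) = Im z * x.
Proof. by case: z => a b /=; rewrite mulr0 add0r. Qed.

End Complex.

(** * Dirichlet characters and their partial sums *)

Section DirichletCharacters.
Local Open Scope complex_scope.
Variables (R : realType) (q : nat).
Hypothesis q_gt1 : (1 < q)%N.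
Local Notation normc := (@Normc.normc R).
Local Notation Re := (@complex.Re R).
Local Notation Im := (@complex.Im R).

Record dirichlet_character (chi : nat -> R[i]) : Prop := {
  dchar1 : chi 1%N = 1;
  dcharM : forall m n, chi (m * n)%N = chi m * chi n;
  dchar_mod : forall n, chi (n %% q)%N = chi n;
  dchar_ncoprime : forall n, ~~ coprime q n -> chi n = 0 }.

Definition principal (chi : nat -> R[i]) := forall n, coprime q n -> chi n = 1.

(** By Euler's theorem [chi n] is a root of unity. *)
Lemma dchar_norm_coprime chi n : dirichlet_character chi -> coprime q n ->
  normc (chi n) = 1.
Proof.
move=> chiP qn; apply/eqP; rewrite -(@pexpr_eq1 _ _ (totient q)) ?normc_ge0//; last first.
  by rewrite totient_gt0 ltnW.
rewrite -normcX; suff -> : chi n ^+ totient q = 1 by rewrite Normc.normc1.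
have E k : chi (n ^ k)%N = chi n ^+ k.
  by elim: k => [|k IH]; rewrite ?(dchar1 chiP)// expnS (dcharM chiP) IH exprS.
rewrite -E -(dchar_mod chiP) Euler_exp_totient ?(dchar_mod chiP) ?(dchar1 chiP)//.
by rewrite coprime_sym.
Qed.

Lemma dchar_norm chi n : dirichlet_character chi -> normc (chi n) <= 1.
Proof.
move=> chiP; have [qn|qn] := boolP (coprime q n).
  by rewrite dchar_norm_coprime.
by rewrite (dchar_ncoprime chiP)// Normc.normc0.
Qed.

Lemma sum_principal chi : dirichlet_character chi -> principal chi ->
  \sum_(0 <= n < q) chi n = (totient q)%:R.
Proof.
move=> chiP pchi; rewrite totient_count_coprime natr_sum.
apply: eq_bigr => n _; case: (boolP (coprime q n)) => qn; first by rewrite pchi.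
by rewrite (dchar_ncoprime chiP).
Qed.

(** Choose n0 coprime to q with [chi n0 != 1]. Multiplication by n0 permutes the residues, so the
    sum is invariant under multiplication by [chi n0]. *)
Lemma sum_nonprincipal chi : dirichlet_character chi -> ~ principal chi ->
  \sum_(0 <= n < q) chi n = 0.
Proof.
move=> chiP npchi.
have [n0 qn0 chin0] : exists2 n0, coprime q n0 & chi n0 != 1.
  apply/not_exists2P => h; apply: npchi => n qn; apply/eqP.
  by have [//|/negP/negPn] := h n.
have q0 : (0 < q)%N by exact: ltnW.
have E : chi n0 * \sum_(0 <= n < q) chi n = \sum_(0 <= n < q) chi n.
  rewrite !big_mkord mulr_sumr.
  pose h (i : 'I_q) : 'I_q := Ordinal (ltn_pmod (n0 * i) q0).
  have hinj : injective h.
    suff H (i j : 'I_q) : (i <= j)%N -> h i = h j -> i = j.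
      move=> i j; case: (leqP i j) => [|/ltnW] ij hij; first exact: H.
      by apply/esym/H.
    move=> ij /(congr1 val)/= /esym/eqP; rewrite eqn_mod_dvd ?leq_mul2l ?ij ?orbT//.
    rewrite -mulnBr Gauss_dvdr// => /dvdnP[[|k] Ek].
      by apply/val_inj => /=; lia.
    have := ltn_ord j; have : (q <= k.+1 * q)%N by rewrite leq_pmull.
    lia.
  rewrite [RHS](reindex_inj hinj)/=; apply: eq_bigr => i _.
  by rewrite (dchar_mod chiP) (dcharM chiP).
have : (chi n0 - 1) * \sum_(0 <= n < q) chi n = 0.
  by rewrite mulrBl E mul1r subrr.
by move/eqP; rewrite mulf_eq0 subr_eq0 (negbTE chin0) => /eqP.
Qed.

(** Full periods cancel, so a sum from 0 is at most q; a general range is a difference of two such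
    sums. *)
Lemma dchar_partial_sum chi m k : dirichlet_character chi -> ~ principal chi ->
  normc (\sum_(m <= i < k) chi i) <= (2 * q)%:R.
Proof.
move=> chiP npchi.
have U l : normc (\sum_(0 <= i < l) chi i) <= q%:R.
  have q0 : (0 < q)%N by exact: ltnW.
  rewrite {1}(divn_eq l q); elim: (l %/ q)%N => [|j IH].
    rewrite mul0n add0n; apply: le_trans (normc_sum _ _ _) _.
    apply: (@le_trans _ _ (\sum_(0 <= i < l %% q) 1)).
      by apply: ler_sum => i _; apply: dchar_norm.
    by rewrite sumr_const_nat subn0 ler_nat ltnW// ltn_pmod.
  rewrite (big_cat_nat (n := q))//=; last by rewrite mulSn -addnA leq_addr.
  rewrite sum_nonprincipal// add0r mulSn -addnA addnC -{1}[q]add0n big_addn addnK.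
  rewrite (eq_bigr chi)// => i _.
  by rewrite -(dchar_mod chiP) modnDr (dchar_mod chiP).
have [mk|/ltnW km] := leqP m k; last by rewrite big_geq// Normc.normc0.
have -> : \sum_(m <= i < k) chi i =
    \sum_(0 <= i < k) chi i + - \sum_(0 <= i < m) chi i.
  by rewrite [in RHS](big_cat_nat (n := m))//= addrAC subrr add0r.
apply: le_trans (normcD _ _) _; rewrite normcN mul2n -addnn natrD.
by rewrite lerD ?U.
Qed.

(** The bound 2 q on partial sums is applied to the real and imaginary parts separately, whence 4
    q. *)
Lemma dchar_abel chi (v : nat -> R) m n :
  dirichlet_character chi -> ~ principal chi -> (m <= n)%N ->
  (forall i, (m <= i)%N -> v i.+1 <= v i) ->
  (forall i, (m <= i)%N -> 0 <= v i) ->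
  normc (\sum_(m <= i < n) chi i * (v i)%:C) <= (4 * q)%:R * v m.
Proof.
move=> chiP npchi mn dv v0; apply: le_trans (normc_le_ReIm _) _.
have -> : (4 * q)%:R * v m = (2 * q)%:R * v m + (2 * q)%:R * v m.
  by rewrite -mulrDl -natrD; congr (_%:R * _); lia.
rewrite Re_sum Im_sum; under eq_bigr do rewrite Re_scale.
under [X in _ + `|X|]eq_bigr do rewrite Im_scale.
apply: lerD; apply: abel_bound => // k.
  by rewrite -Re_sum; apply: le_trans (Re_le_normc _) (dchar_partial_sum _ _ _ _).
by rewrite -Im_sum; apply: le_trans (Im_le_normc _) (dchar_partial_sum _ _ _ _).
Qed.

Lemma dchar_series chi (v : nat -> R) a :
  dirichlet_character chi -> ~ principal chi ->
  (forall i, (a <= i)%N -> v i.+1 <= v i) ->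
  (forall i, (a <= i)%N -> 0 <= v i) ->
  exists L : R[i], forall n, (a <= n)%N ->
  normc (\sum_(a <= i < n) chi i * (v i)%:C - L) <= (4 * q)%:R * v n.
Proof.
move=> chiP npchi dv v0.
have [m k|Lr HLr] := @dirichlet_test R (fun i => Re (chi i)) v (2 * q)%:R a _ dv v0.
  by rewrite -Re_sum; apply: le_trans (Re_le_normc _) (dchar_partial_sum _ _ _ _).
have [m k|Li HLi] := @dirichlet_test R (fun i => Im (chi i)) v (2 * q)%:R a _ dv v0.
  by rewrite -Im_sum; apply: le_trans (Im_le_normc _) (dchar_partial_sum _ _ _ _).
exists (Lr +i* Li) => n an; apply: le_trans (normc_le_ReIm _) _.
have -> : (4 * q)%:R * v n = (2 * q)%:R * v n + (2 * q)%:R * v n.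
  by rewrite -mulrDl -natrD; congr (_%:R * _); lia.
have ReB (z w : R[i]) : Re (z - w) = Re z - Re w by case: z => ? ?; case: w.
have ImB (z w : R[i]) : Im (z - w) = Im z - Im w by case: z => ? ?; case: w.
rewrite ReB ImB Re_sum Im_sum; under eq_bigr do rewrite Re_scale.
under [X in _ + `|X - _|]eq_bigr do rewrite Im_scale.
by apply: lerD; [apply: HLr|apply: HLi].
Qed.

Lemma dirichlet_characters : exists X : 'I_(totient q) -> nat -> R[i],
  (forall i, dirichlet_character (X i)) /\
  forall n, coprime q n ->
    \sum_i X i n = (totient q * (n == 1 %[mod q]))%:R.
Proof.
have q0 : (0 < q)%N by exact: ltnW.
have [X [X1 XM Xsum]] := @abelian_characters R[i] {unit 'Z_q}
  (units_Zp_abelian q).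
have cU : totient q = #|{: {unit 'Z_q}}| by rewrite -card_units_Zp// cardsT.
(* Integers not coprime to q get the default value 1; the characters are set to 0 there. *)
pose u n : {unit 'Z_q} := insubd (1%g : {unit 'Z_q}) (n%:R : 'Z_q).
have uE n : coprime q n -> val (u n) = n%:R.
  by move=> qn; rewrite /u val_insubd unitZpE ?qn.
exists (fun i n => if coprime q n then X (cast_ord cU i) (u n) else 0); split.
  move=> i; split.
  - rewrite coprimen1 (_ : u 1%N = 1%g) ?X1//.
    by apply: val_inj; rewrite uE ?coprimen1.
  - move=> m n; rewrite coprimeMr.
    have [qm|] := boolP (coprime q m); last by rewrite mul0r.
    have [qn|] := boolP (coprime q n); last by rewrite mulr0.
    rewrite /= -XM; congr (X _ _); apply: val_inj.
    by rewrite uE ?coprimeMr ?qm// natrM /= !uE.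
  - by move=> n; rewrite coprime_modr /u Zp_nat_mod.
  - by move=> n /negbTE ->.
move=> n qn; rewrite qn [in RHS]cU (reindex (cast_ord (esym cU)))/=; last first.
  by exists (cast_ord cU) => j _; rewrite ?cast_ordK ?cast_ordKV.
under eq_bigr do rewrite cast_ordKV.
rewrite Xsum; congr ((_ * nat_of_bool _)%:R).
rewrite -(inj_eq val_inj) uE//= -(inj_eq val_inj)/= val_Zp_nat//.
by rewrite Zp_cast.
Qed.

(** Sum the orthogonality relation over n < q. A principal character contributes [totient q], the
    others 0, and on the other side only n = 1 survives. Hence exactly one index is principal. *)
Lemma dirichlet_characters_principal (X : 'I_(totient q) -> nat -> R[i]) :
  (forall i, dirichlet_character (X i)) ->
  (forall n, coprime q n ->
    \sum_i X i n = (totient q * (n == 1 %[mod q]))%:R) ->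
  \sum_i `[< principal (X i) >]%:R = 1 :> R.
Proof.
move=> XP Xsum.
have t0 : (totient q)%:R != 0 :> R[i] by rewrite pnatr_eq0 -lt0n totient_gt0 ltnW.
suff E : (totient q)%:R * \sum_i `[< principal (X i) >]%:R = (totient q)%:R :> R[i].
  apply: (@complexI R); rewrite rmorph_sum/= rmorph1.
  apply: (mulfI t0); rewrite mulr1 -[RHS]E; congr (_ * _).
  by apply: eq_bigr => i _; rewrite rmorph_nat.
transitivity (\sum_i \sum_(0 <= n < q) X i n).
  rewrite mulr_sumr; apply: eq_bigr => i _; case: asboolP => pX.
    by rewrite mulr1 sum_principal.
  by rewrite mulr0 sum_nonprincipal.
rewrite exchange_big/=.
transitivity (\sum_(0 <= n < q) (if n == 1%N then (totient q)%:R else 0 : R[i])).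
  apply: eq_big_nat => n /andP[_ nq]; have [qn|qn] := boolP (coprime q n).
    by rewrite Xsum// !modn_small//; case: eqP; rewrite ?muln1 ?muln0.
  rewrite big1; last by move=> i _; rewrite (dchar_ncoprime (XP i)).
  by case: eqP => // n1; rewrite n1 coprimen1 in qn.
by rewrite -big_mkcond/= big_nat1_eq q_gt1.
Qed.

End DirichletCharacters.

(** * The convolution of 1 with a real character *)

Section RealCharacterDivisorSum.
Variables (R : realDomainType) (c : nat -> R).
Hypothesis c1 : c 1%N = 1.
Hypothesis cM : forall m n, c (m * n)%N = c m * c n.
Hypothesis c_sign : forall n, [\/ c n = 0, c n = 1 | c n = -1].
Let r n := \sum_(d <- divisors n) c d.

(** The divisors divisible by p are p times the divisors of p^k m; the others are the divisors of
    m. *)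
Lemma divisor_sum_prime_power p k m : prime p -> (0 < m)%N -> ~~ (p %| m)%N ->
  r (p ^ k.+1 * m)%N = c p * r (p ^ k * m)%N + r m.
Proof.
move=> pp m0 pm; have p0 := prime_gt0 pp.
have n0 l : (0 < p ^ l * m)%N by rewrite muln_gt0 expn_gt0 p0.
rewrite /r (bigID (fun d => p %| d)%N)/= expnS -mulnA big_divisors_mul//.
rewrite [X in X + _](eq_bigr (fun e => c p * c e)); last by move=> e _; exact: cM.
rewrite -mulr_sumr; congr (_ + _).
have -> : \sum_(d <- divisors (p * (p ^ k * m)) | ~~ (p %| d)%N) c d =
          \sum_(d <- divisors m | ~~ (p %| d)%N) c d.
  elim: k => [|k IH].
    by rewrite expn0 mul1n; apply: big_divisors_coprime => //; rewrite muln_gt0 p0.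
  rewrite -IH; apply: big_divisors_coprime; rewrite ?expnS ?mulnA//.
  by rewrite !muln_gt0 expn_gt0 p0 m0.
rewrite big_mkcond/= big_seq [RHS]big_seq; apply: eq_bigr => d.
rewrite -dvdn_divisors// => dm; case: (boolP (p %| d)%N) => // pd.
by rewrite (dvdn_trans pd dm) in pm.
Qed.

(** Two steps of the recursion add (c p + 1) r m >= 0 to (c p)^2 times the value at p^k m. If c p =
    -1, the odd powers give 0, so the lower bound by r m is claimed for even k. *)
Lemma divisor_sum_prime_power_ge0 p k m : prime p -> (0 < m)%N ->
  ~~ (p %| m)%N -> 0 <= r m ->
  (0 <= r (p ^ k * m)%N) && (odd k || (r m <= r (p ^ k * m)%N)).
Proof.
move=> pp m0 pm rm.
have S2 l : r (p ^ l.+2 * m)%N = c p * (c p * r (p ^ l * m)%N + r m) + r m.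
  by rewrite !divisor_sum_prime_power.
elim/ltn_ind: k => -[|[|k]] IH; first by rewrite expn0 mul1n rm lexx.
  rewrite orTb andbT divisor_sum_prime_power// expn0 mul1n.
  by case: (c_sign p) => ->; rewrite ?mul0r ?mul1r ?mulN1r ?addNr ?add0r ?addr_ge0.
have /andP[h1 h2] := IH k (leqW (leqnn _)).
rewrite S2 /= negbK; case: (c_sign p) => ->.
- by rewrite mul0r add0r rm lexx orbT.
- rewrite !mul1r -addrA !addr_ge0//=; case: (odd k) h2 => //= h2.
  by rewrite -[leLHS]add0r lerD// lerDl.
- by rewrite !mulN1r opprD opprK subrK h1.
Qed.

Lemma divisor_sum_ge0 n : (0 < n)%N -> 0 <= r n.
Proof.
elim/ltn_ind: n => n IH n0; have [->|n1] := eqVneq n 1%N.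
  by rewrite /r (_ : divisors 1 = [:: 1%N])// big_seq1 c1 ler01.
have pp : prime (pdiv n) by rewrite pdiv_prime// ltn_neqAle eq_sym n1.
have [m pm En] := pfactor_coprime pp n0.
have m0 : (0 < m)%N by move: n0; rewrite En; case: (m).
have l0 : (0 < logn (pdiv n) n)%N by rewrite logn_gt0 mem_primes pp n0 pdiv_dvd.
have mn : (m < n)%N by rewrite [ltnRHS]En ltn_Pmulr// -(exp1n (logn (pdiv n) n))
    ltn_exp2r// prime_gt1.
rewrite [n in r n]En mulnC; rewrite prime_coprime// in pm.
by case/andP: (divisor_sum_prime_power_ge0 (logn (pdiv n) n) pp m0 pm (IH _ mn m0)).
Qed.

(** A square has even exponents only, so removing one prime at a time never increases r. *)
Lemma divisor_sum_square_ge1 n : (0 < n)%N -> 1 <= r (n ^ 2)%N.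
Proof.
elim/ltn_ind: n => n IH n0; have [->|n1] := eqVneq n 1%N.
  by rewrite /r (_ : divisors (1 ^ 2) = [:: 1%N])// big_seq1 c1.
have pp : prime (pdiv n) by rewrite pdiv_prime// ltn_neqAle eq_sym n1.
have [m pm En] := pfactor_coprime pp n0.
have m0 : (0 < m)%N by move: n0; rewrite En; case: (m).
have l0 : (0 < logn (pdiv n) n)%N by rewrite logn_gt0 mem_primes pp n0 pdiv_dvd.
have mn : (m < n)%N by rewrite [ltnRHS]En ltn_Pmulr// -(exp1n (logn (pdiv n) n))
    ltn_exp2r// prime_gt1.
rewrite prime_coprime// in pm.
have pm2 : ~~ (pdiv n %| m ^ 2)%N by rewrite Euclid_dvdX// andbT.
have m20 : (0 < m ^ 2)%N by rewrite expn_gt0 m0.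
have h := divisor_sum_prime_power_ge0 ((logn (pdiv n) n).*2) pp m20 pm2.
have /andP[_] := h (divisor_sum_ge0 m20); rewrite odd_double/= => h2.
rewrite [n in r (n ^ 2)%N]En expnMn -expnM muln2 mulnC.
exact: le_trans (IH _ mn m0) h2.
Qed.

(** The nonsquare indices are dropped, since r >= 0, and r >= 1 on squares. This is what makes the
    Lambert series large as t approaches 1. *)
Lemma sum_squares_le (t : R) J : 0 <= t ->
  \sum_(1 <= j < J.+1) t ^+ (j ^ 2) <=
  \sum_(1 <= m < (J ^ 2).+1) r m * t ^+ m.
Proof.
move=> t0; elim: J => [|J IH]; first by rewrite !big_geq.
have lt : (J ^ 2 < J.+1 ^ 2)%N by rewrite ltn_sqr.
rewrite big_nat_recr//= [leRHS](big_cat_nat (n := (J ^ 2).+1))//=; last first.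
  by rewrite ltnS ltnW.
apply: lerD => //; rewrite big_nat_recr//=.
rewrite -[leLHS]add0r; apply: lerD.
  rewrite big_nat; apply: sumr_ge0 => m /andP[m0 _].
  by rewrite mulr_ge0 ?exprn_ge0// divisor_sum_ge0// (leq_trans _ m0).
by rewrite ler_peMl ?exprn_ge0// divisor_sum_square_ge1.
Qed.

End RealCharacterDivisorSum.

(** * Monotonicity of the Lambert weights *)

Section LambertWeights.
Variables (R : realFieldType) (t : R).
Hypothesis t01 : 0 < t < 1.
Let S n := \sum_(i < n) t ^+ i.

Let t_gt0 : 0 < t. Proof. by case/andP: t01. Qed.
Let t_lt1 : t < 1. Proof. by case/andP: t01. Qed.
Let onemt_gt0 : 0 < 1 - t. Proof. by rewrite subr_gt0. Qed.

Lemma geometric_sum_mul n : (1 - t) * S n = 1 - t ^+ n.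
Proof.
rewrite /S; elim: n => [|n IH]; first by rewrite big_ord0 mulr0 expr0 subrr.
by rewrite big_ord_recr/= mulrDr IH exprS; ring.
Qed.

Lemma geometric_sum_ge n : n%:R * t ^+ n <= S n.
Proof.
rewrite /S; elim: n => [|n IH]; first by rewrite big_ord0 mul0r.
rewrite big_ord_recr/= -natr1 mulrDl mul1r; apply: lerD.
  by apply: le_trans IH; rewrite ler_wpM2l// ler_wiXn2l ?ltW.
by rewrite ler_wiXn2l ?ltW.
Qed.

(** By AM-GM the sum is at least 2 t^(n - 1/2) >= 2 t^n. To avoid half-integral exponents, t^s is
    factored out and a square (1 - t^(d+1))^2 is used. *)
Lemma geometric_pair_ge n s s' : (s + s').+1 = n.*2 -> 2 * t ^+ n <= t ^+ s + t ^+ s'.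
Proof.
wlog ss : s s' / (s <= s')%N => [H E|E].
  have [/H|/ltnW/H] := leqP s s'; first exact.
  by rewrite addrC; apply; rewrite addnC.
have [d Ed] : exists d, n = (s + d.+1)%N.
  by exists (n - s).-1; rewrite prednK ?subnKC; lia.
have -> : s' = (s + (d.*2).+1)%N by lia.
rewrite Ed !exprD mulrCA -{2}[t ^+ s]mulr1 -mulrDr ler_wpM2l ?exprn_ge0 ?(ltW t_gt0)//.
have h : t ^+ d.+1 ^+ 2 <= t ^+ d.*2.+1.
  by rewrite -exprM ler_wiXn2l ?ltW//; lia.
have := sqr_ge0 (1 - t ^+ d.+1); rewrite sqrrB expr1n mul1r mulr2n; lra.
Qed.

(** Average the double sum of t^(i + j) with its reflection under i -> n - 1 - i, j -> n - j: the
    paired exponents add up to 2n - 1. *)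
Lemma geometric_sum_prod_ge n : (n * n.+1)%:R * t ^+ n <= S n * S n.+1.
Proof.
have E : S n * S n.+1 = \sum_(i < n) \sum_(j < n.+1) t ^+ (i + j).
  rewrite /S mulr_suml; apply: eq_bigr => i _; rewrite mulr_sumr.
  by apply: eq_bigr => j _; rewrite exprD.
have E' : S n * S n.+1 = \sum_(i < n) \sum_(j < n.+1) t ^+ ((n.-1 - i) + (n - j)).
  rewrite E (reindex_inj rev_ord_inj)/=; apply: eq_bigr => i _.
  rewrite (reindex_inj rev_ord_inj)/=; apply: eq_bigr => j _.
  by rewrite subSS; congr (_ ^+ (_ + _)); lia.
have : 2 * ((n * n.+1)%:R * t ^+ n) <= S n * S n.+1 + S n * S n.+1.
  rewrite {1}E E' -big_split/=.
  apply: (@le_trans _ _ (\sum_(i < n) \sum_(j < n.+1) 2 * t ^+ n)).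
    by rewrite !sumr_const !card_ord -mulrnA -[leRHS]mulr_natr [(n.+1 * n)%N]mulnC -mulrA [t ^+ n * _]mulrC.
  apply: ler_sum => i _; rewrite -big_split/=; apply: ler_sum => j _.
  by apply: geometric_pair_ge; have := ltn_ord i; have := ltn_ord j; lia.
lra.
Qed.

(** The leading term of the Lambert weight as t tends to 1, minus that weight. It is nonnegative and
    decreasing in n, as Abel summation requires. *)
Definition lambert_gap n := (n%:R * (1 - t))^-1 - t ^+ n / (1 - t ^+ n).

Let S_gt0 n : (0 < n)%N -> 0 < S n.
Proof.
move=> n0; apply: lt_le_trans (geometric_sum_ge n).
by rewrite mulr_gt0 ?ltr0n// exprn_gt0.
Qed.

Lemma lambert_gapE n : (0 < n)%N ->
  lambert_gap n = (n%:R^-1 - t ^+ n / S n) / (1 - t).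
Proof.
move=> n0; rewrite /lambert_gap -geometric_sum_mul; field.
by rewrite !gt_eqF ?S_gt0 ?ltr0n.
Qed.

Lemma lambert_gap_ge0 n : (0 < n)%N -> 0 <= lambert_gap n.
Proof.
move=> n0; rewrite lambert_gapE// divr_ge0 ?(ltW onemt_gt0)// subr_ge0.
rewrite ler_pdivrMr ?S_gt0// ler_pdivlMl ?ltr0n//.
exact: geometric_sum_ge.
Qed.

Lemma lambert_gap1 : lambert_gap 1 = 1.
Proof. by rewrite /lambert_gap mul1r expr1; field; rewrite gt_eqF. Qed.

(** The difference of consecutive gaps, times 1 - t, is 1 / (n (n + 1)) - t^n / (S n * S (n +
    1)). *)
Lemma lambert_gap_decr n : (0 < n)%N -> lambert_gap n.+1 <= lambert_gap n.
Proof.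
move=> n0; rewrite !lambert_gapE// ler_pM2r ?invr_gt0//.
have SS : S n.+1 = 1 + t * S n.
  rewrite /S big_ord_recl/= expr0 mulr_sumr; congr (_ + _).
  by apply: eq_bigr => i _; rewrite -exprS.
have -> : n.+1%:R^-1 - t ^+ n.+1 / S n.+1 =
    n%:R^-1 - t ^+ n / S n - ((n * n.+1)%:R^-1 - t ^+ n / (S n * S n.+1)).
  rewrite SS natrM -natr1 exprS; field.
  by rewrite -SS natr1 !gt_eqF ?S_gt0 ?ltr0n.
rewrite gerBl subr_ge0 ler_pdivrMr ?mulr_gt0 ?S_gt0//.
by rewrite ler_pdivlMl ?ltr0n ?muln_gt0 ?n0// geometric_sum_prod_ge.
Qed.

End LambertWeights.

(** * Nonvanishing for real characters *)

Section RealNonvanishing.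
Variables (R : realType) (c : nat -> R) (B : R).
Hypothesis c1 : c 1%N = 1.
Hypothesis cM : forall m n, c (m * n)%N = c m * c n.
Hypothesis c_sign : forall n, [\/ c n = 0, c n = 1 | c n = -1].
Hypothesis c_bound : forall m k, `|\sum_(m <= i < k) c i| <= B.

Let c_norm n : `|c n| <= 1.
Proof. by case: (c_sign n) => ->; rewrite ?normr0 ?normrN ?normr1 ?ler01. Qed.

(** Each Lambert term is a geometric series in t^n; its part with n k <= N is regrouped by m = n k,
    and each of the N tails is at most t^N / (1 - t). *)
Lemma lambert_sum_lower (t : R) N : 0 < t < 1 ->
  \sum_(1 <= m < N.+1) (\sum_(d <- divisors m) c d) * t ^+ m
    - N%:R * (t ^+ N / (1 - t)) <=
  \sum_(1 <= n < N.+1) c n * (t ^+ n / (1 - t ^+ n)).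
Proof.
move=> /andP[t0 t1].
have tn1 n : (0 < n)%N -> 0 < 1 - t ^+ n.
  by move=> n0; rewrite subr_gt0 exprn_ilt1 ?ltW// -lt0n.
have -> : \sum_(1 <= m < N.+1) (\sum_(d <- divisors m) c d) * t ^+ m =
    \sum_(1 <= n < N.+1) \sum_(1 <= k < (N %/ n).+1) c n * t ^+ (n * k).
  rewrite -(sum_divisors_hyperbola N (fun d k => c d * t ^+ (d * k))).
  apply: eq_big_nat => m /andP[m0 _]; rewrite mulr_suml big_seq [RHS]big_seq.
  by apply: eq_bigr => d; rewrite -dvdn_divisors// => dm; rewrite mulnC divnK.
have -> : N%:R * (t ^+ N / (1 - t)) = \sum_(1 <= n < N.+1) t ^+ N / (1 - t).
  by rewrite sumr_const_nat subn1 mulr_natl.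
rewrite -sumrB big_nat [leRHS]big_nat; apply: ler_sum => n /andP[n0 nN].
rewrite -mulr_sumr lerBlDr -lerBlDl -mulrBr.
have geo K : \sum_(1 <= k < K.+1) t ^+ (n * k) =
    t ^+ n / (1 - t ^+ n) - t ^+ (n * K.+1) / (1 - t ^+ n).
  elim: K => [|K IH]; first by rewrite big_geq// muln1 subrr.
  rewrite big_nat_recr//= IH [(n * K.+2)%N]mulnS exprD; field.
  by rewrite gt_eqF// tn1.
rewrite geo addrAC subrr add0r.
apply: le_trans (ler_norm _) _; rewrite normrM normrN.
have h0 : 0 <= t ^+ (n * (N %/ n).+1) / (1 - t ^+ n).
  by rewrite divr_ge0 ?exprn_ge0 ?ltW ?tn1.
apply: (@le_trans _ _ `|t ^+ (n * (N %/ n).+1) / (1 - t ^+ n)|).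
  by rewrite -[leRHS]mul1r ler_wpM2r.
rewrite ger0_norm//; apply: ler_pM.
- by rewrite exprn_ge0// ltW.
- by rewrite invr_ge0 ltW// tn1.
- by rewrite ler_wiXn2l ?ltW// mulnC ltnW// ltn_ceil.
rewrite lef_pV2 ?posrE ?tn1//; last by rewrite subr_gt0.
rewrite lerD2l lerN2.
by rewrite -[leRHS]expr1 ler_wiXn2l ?ltW.
Qed.

(** The leading terms 1 / (n (1 - t)) reproduce the L-value sum, which gives K; the gaps give B by
    Abel summation, as the first gap is 1. *)
Lemma lambert_sum_upper (t : R) N (K : R) : 0 < t < 1 ->
  `|\sum_(1 <= n < N.+1) c n / n%:R| <= K * (1 - t) ->
  \sum_(1 <= n < N.+1) c n * (t ^+ n / (1 - t ^+ n)) <= K + B.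
Proof.
move=> t01 hK; have t1 : 0 < 1 - t by rewrite subr_gt0; case/andP: t01.
have -> : \sum_(1 <= n < N.+1) c n * (t ^+ n / (1 - t ^+ n)) =
   (1 - t)^-1 * (\sum_(1 <= n < N.+1) c n / n%:R) -
   \sum_(1 <= n < N.+1) c n * lambert_gap t n.
  rewrite mulr_sumr -sumrB; apply: eq_big_nat => n /andP[n0 _].
  by rewrite /lambert_gap invfM; ring.
apply: le_trans (ler_norm _) _; apply: le_trans (ler_normB _ _) _.
apply: lerD.
  by rewrite normrM gtr0_norm ?invr_gt0// mulrC ler_pdivrMr.
rewrite -[leRHS]mulr1 -(lambert_gap1 t01).
by apply: abel_bound => // i i0; [apply: lambert_gap_decr|apply: lambert_gap_ge0].
Qed.

(* Monsky: with t = 1 - 1/X, X = 2 J^2 and N = 2 X^3 the Lambert sum is at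
   least J / 2 - 1, and it is bounded if the L-value vanishes. *)
Lemma real_character_nonvanishing (K : R) :
  ~ (forall n, `|\sum_(1 <= i < n.+1) c i / i%:R| <= K / n.+1%:R).
Proof.
move=> hK.
have K0 : 0 <= K.
  by have := le_trans (normr_ge0 _) (hK 0%N); rewrite divr1.
suff H J : (0 < J)%N -> J%:R <= 2 * (K + B + 1).
  have B0 : 0 <= B by apply: le_trans (c_bound 0%N 0%N).
  have := truncnS_gt (2 * (K + B + 1)).
  by rewrite ltNge H.
move=> J0.
have [X EX] : exists X, X = (2 * J ^ 2)%N by exists (2 * J ^ 2)%N.
have X2 : (2 <= X)%N by rewrite EX leq_pmulr// expn_gt0 J0.
have X0 : (0 < X)%N by exact: leq_trans X2.
have [N EN] : exists N, N = (2 * X ^ 3)%N by exists (2 * X ^ 3)%N.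
have XN : (X <= N)%N by rewrite EN expnS mulnCA leq_pmulr// muln_gt0 expn_gt0 X0.
have EN' : N%:R = 2 * X%:R ^+ 3 :> R by rewrite EN natrM natrX.
have X2' : (2 : R) <= X%:R by rewrite ler_nat.
have X0' : (0 : R) < X%:R by lra.
pose t : R := 1 - X%:R^-1.
have Xi : 0 < X%:R^-1 :> R by rewrite invr_gt0.
have Xi2 : X%:R^-1 <= 2^-1 :> R by rewrite lef_pV2 ?posrE.
have t01 : 0 < t < 1 by rewrite /t; apply/andP; split; lra.
have omt : 1 - t = X%:R^-1 by rewrite /t; lra.
(* Here N / (1 - t) = 2 X^4, while t <= exp (- 1/X) gives t^N <= exp (- 2 X^2) <= 1 / (2 X^4), by
   the quadratic Taylor term of exp. *)
have tN : N%:R * (t ^+ N / (1 - t)) <= 1.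
  have h1 : t ^+ N <= expR (- (2 * X%:R ^+ 2)).
    have -> : - (2 * X%:R ^+ 2) = N%:R * (- X%:R^-1) :> R.
      by rewrite EN'; field; rewrite gt_eqF.
    rewrite expRM_natl; apply: lerXn2r; rewrite ?nnegrE ?expR_ge0//.
      by case/andP: t01 => /ltW.
    exact: expR_ge1Dx.
  have h2 : 2 * X%:R ^+ 4 <= expR (2 * X%:R ^+ 2) :> R.
    apply: le_trans (expR_ge1Dxn 1 _); last by rewrite mulr_ge0// exprn_ge0// ltW.
    rewrite (_ : 2`! = 2%N)//; have := sqr_ge0 (X%:R ^+ 2 : R); lra.
  have h3 : 0 < 2 * X%:R ^+ 4 :> R by rewrite mulr_gt0// exprn_gt0.
  rewrite omt invrK.
  have -> : N%:R * (t ^+ N * X%:R) = (2 * X%:R ^+ 4) * t ^+ N.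
    by rewrite EN'; ring.
  rewrite -ler_pdivlMl// mulr1; apply: le_trans h1 _.
  by rewrite expRN lef_pV2 ?posrE ?expR_gt0.
have hu := @lambert_sum_upper t N K t01.
have hl := @lambert_sum_lower t N t01.
have hB : `|\sum_(1 <= n < N.+1) c n / n%:R| <= K * (1 - t).
  apply: le_trans (hK N) _; rewrite omt ler_wpM2l//.
  by rewrite lef_pV2 ?posrE ?ltr0n// ler_nat leqW.
have hJ : J%:R / 2 <= \sum_(1 <= m < N.+1) (\sum_(d <- divisors m) c d) * t ^+ m.
  have J2 : (J ^ 2 <= N)%N by apply: leq_trans XN; rewrite EX leq_pmull.
  rewrite (big_cat_nat (n := (J ^ 2).+1))//=.
  rewrite -[leLHS]addr0; apply: lerD; last first.
    rewrite big_nat sumr_ge0// => m /andP[m0 _]; apply: mulr_ge0.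
      by apply: divisor_sum_ge0 => //; exact: leq_trans m0.
    by rewrite exprn_ge0// ltW//; case/andP: t01.
  apply: le_trans (sum_squares_le c1 cM c_sign _ _); last by rewrite ltW//; case/andP: t01.
  have -> : J%:R / 2 = \sum_(1 <= j < J.+1) 2^-1 :> R.
    by rewrite sumr_const_nat subn1 mulr_natl.
  rewrite big_nat [leRHS]big_nat; apply: ler_sum => j /andP[j0 jJ].
  (* Bernoulli: for j <= J, t^(j^2) >= 1 - j^2 / X >= 1/2, which is why X = 2 J^2. *)
  have bern n : 1 - n%:R * X%:R^-1 <= t ^+ n.
    elim: n => [|n IH]; first by rewrite mul0r subr0 expr0.
    rewrite exprS -natr1; have /andP[t0 t1] := t01.
    apply: le_trans (ler_wpM2l (ltW t0) IH); rewrite /t.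
    have : 0 <= n%:R * X%:R^-1 * X%:R^-1 :> R by rewrite !mulr_ge0// ltW.
    lra.
  apply: le_trans (bern _).
  have : (j ^ 2)%:R * X%:R^-1 <= 2^-1 :> R.
    rewrite ler_pdivrMr// ler_pdivlMl// -natrM ler_nat EX leq_mul2l/=.
    by rewrite leq_sqr.
  lra.
have := hu hB; lra.
Qed.

End RealNonvanishing.

(** * Moebius inversion of the logarithm *)

Section MoebiusLog.
Local Open Scope complex_scope.
Variable R : realType.
Local Notation lnn n := (ln (n%:R : R)).

(** Write ln d as ln n minus the [mangoldt] sum over the divisors of n / d. The first part vanishes,
    since [moebius] sums to 0 unless n = 1, where ln n = 0; the second is [mangoldt] by
    inversion. *)
Lemma sum_moebius_ln n : (0 < n)%N ->
  \sum_(d <- divisors n) (moebius d)%:~R * lnn d = - mangoldt R n.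
Proof.
move=> n0.
transitivity (\sum_(d <- divisors n) ((moebius d)%:~R * lnn n -
    \sum_(e <- divisors (n %/ d)) (moebius d)%:~R * mangoldt R e)).
  rewrite big_seq [RHS]big_seq; apply: eq_bigr => d; rewrite -dvdn_divisors// => dn.
  have d0 := dvdn_gt0 n0 dn.
  have nd0 : (0 < n %/ d)%N by rewrite divn_gt0// dvdn_leq.
  rewrite -mulr_sumr sum_mangoldt// -mulrBr; congr (_ * _).
  by rewrite -{1}(divnK dn) lnnM// addrC addKr.
rewrite sumrB -mulr_suml -rmorph_sum/= sum_moebius//.
rewrite (exchange_divisors (fun d e => (moebius d)%:~R * mangoldt R e))//.
have -> : (n == 1%N)%:R%:~R * lnn n = 0.
  by case: eqP => [->|_]; rewrite ?ln1 ?mulr0 ?mul0r.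
rewrite add0r; congr (- _).
have nn : n \in divisors n by rewrite -dvdn_divisors.
rewrite (bigD1_seq n) ?divisors_uniq//= [X in _ + X]big_seq_cond [X in _ + X]big1 ?addr0.
  by rewrite -mulr_suml -rmorph_sum/= divnn n0 sum_moebius// mul1r.
move=> e /andP[]; rewrite -dvdn_divisors// => en ne.
have e0 := dvdn_gt0 n0 en.
rewrite -mulr_suml -rmorph_sum/= sum_moebius; last by rewrite divn_gt0// dvdn_leq.
case: eqP => [E|]; last by rewrite mul0r.
by move: ne; rewrite -{1}(divnK en) E mul1n eqxx.
Qed.

Lemma ln_unbounded (C : R) : exists2 N, (0 < N)%N & C < lnn N.
Proof.
exists (Num.truncn (expR C)).+1 => //.
rewrite -[ltLHS]expRK ltr_ln ?posrE ?expR_gt0 ?ltr0n//.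
exact: truncnS_gt.
Qed.

End MoebiusLog.

(** * Mertens sums twisted by a nonprincipal character *)

Section CharacterMertens.
Local Open Scope complex_scope.
Variables (R : realType) (q : nat).
Hypothesis q_gt1 : (1 < q)%N.
Local Notation normc := (@Normc.normc R).
Local Notation Re := (@complex.Re R).
Local Notation lnn n := (ln (n%:R : R)).

Implicit Types chi : nat -> R[i].

Definition char_mangoldt (chi : nat -> R[i]) N : R[i] :=
  \sum_(1 <= n < N.+1) chi n * (n%:R^-1 * mangoldt R n)%:C.

Section OneCharacter.
Variable chi : nat -> R[i].
Hypotheses (chiP : dirichlet_character q chi) (npchi : ~ principal q chi).

Lemma inv_succ_le (i : nat) : (0 < i)%N -> i.+1%:R^-1 <= i%:R^-1 :> R.
Proof. by move=> i0; rewrite lef_pV2 ?posrE ?ltr0n// ler_nat. Qed.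

Lemma char_L1 : exists L : R[i], forall N,
  normc (\sum_(1 <= i < N.+1) chi i * (i%:R^-1)%:C - L) <= (4 * q)%:R / N.+1%:R.
Proof.
have [||L HL] := @dchar_series R q q_gt1 chi (fun i => i%:R^-1) 1%N chiP npchi.
- exact: inv_succ_le.
- by move=> i _; rewrite invr_ge0.
by exists L => N; exact: HL.
Qed.

(** Since ln n / n is not monotone for small n, Abel summation is applied to (ln n + 1) / n and to 1
    / n. *)
Lemma char_ln_bound N : (0 < N)%N ->
  normc (\sum_(1 <= n < N.+1) chi n * (n%:R^-1 * lnn n)%:C) <= (8 * q)%:R.
Proof.
move=> N0.
have h1 : normc (\sum_(1 <= i < N.+1) chi i * (i%:R^-1)%:C) <= (4 * q)%:R * 1%:R^-1.
  apply: (dchar_abel q_gt1 chiP npchi (v := fun i => i%:R^-1)) => // i i0.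
    exact: inv_succ_le.
have h2 : normc (\sum_(1 <= i < N.+1) chi i * (i%:R^-1 * (lnn i + 1))%:C) <=
    (4 * q)%:R * (1%:R^-1 * (lnn 1 + 1)).
  apply: (dchar_abel q_gt1 chiP npchi (v := fun i => i%:R^-1 * (lnn i + 1))) => // i i0.
    have /andP[_ h] := ln_succ_sub R i0; have l0 := lnn_ge0 R i.
    have i0' : (0 : R) < i%:R by rewrite ltr0n.
    have h3 : i%:R * (lnn i.+1 - lnn i) <= 1 by rewrite mulrC -ler_pdivlMr// mul1r.
    rewrite ler_pdivrMl ?ltr0n// mulrCA ler_pdivlMl// -natr1; move: h3.
    by rewrite -natr1; set a := ln _; set b := ln _ in l0 *; nra.
  by rewrite mulr_ge0 ?invr_ge0// addr_ge0// lnn_ge0.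
have -> : \sum_(1 <= n < N.+1) chi n * (n%:R^-1 * lnn n)%:C =
   \sum_(1 <= i < N.+1) chi i * (i%:R^-1 * (lnn i + 1))%:C +
   - \sum_(1 <= i < N.+1) chi i * (i%:R^-1)%:C.
  rewrite -sumrB; apply: eq_bigr => i _; rewrite -mulrBr -rmorphB/=.
  by congr (_ * _%:C); ring.
apply: le_trans (normcD _ _) _; rewrite normcN.
have -> : (8 * q)%:R = (4 * q)%:R + (4 * q)%:R :> R by rewrite -natrD; congr _%:R; lia.
move: h1 h2; rewrite ln1 add0r invr1 !mulr1; move=> h1 h2; exact: lerD h2 h1.
Qed.

(** The hyperbola form has the inner sums of chi(k) / k up to N / d; replacing each by L costs 4 q /
    (floor(N/d) + 1), and d (floor(N/d) + 1) >= N. *)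
Lemma char_convolution (G : nat -> R) (L : R[i]) N : (0 < N)%N ->
  (forall N, normc (\sum_(1 <= i < N.+1) chi i * (i%:R^-1)%:C - L)
     <= (4 * q)%:R / N.+1%:R) ->
  normc (\sum_(1 <= n < N.+1) chi n * (n%:R^-1 * \sum_(d <- divisors n) G d)%:C -
         L * \sum_(1 <= d < N.+1) chi d * (d%:R^-1 * G d)%:C) <=
  (4 * q)%:R / N%:R * \sum_(1 <= d < N.+1) `|G d|.
Proof.
move=> N0 HL; pose F d k := (chi d * (d%:R^-1 * G d)%:C) * (chi k * (k%:R^-1)%:C).
have -> : \sum_(1 <= n < N.+1) chi n * (n%:R^-1 * \sum_(d <- divisors n) G d)%:C =
    \sum_(1 <= d < N.+1) \sum_(1 <= k < (N %/ d).+1) F d k.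
  rewrite -sum_divisors_hyperbola; apply: eq_big_nat => n /andP[n0 _].
  rewrite mulr_sumr rmorph_sum/= mulr_sumr big_seq [RHS]big_seq.
  apply: eq_bigr => d; rewrite -dvdn_divisors// => dn.
  rewrite /F mulrACA -(dcharM chiP) mulnC divnK// -rmorphM/=; congr (_ * _%:C).
  by rewrite mulrAC -invfM -natrM mulnC divnK.
rewrite mulr_sumr -sumrB mulr_sumr.
apply: le_trans (normc_sum _ _ _) _; rewrite big_nat [leRHS]big_nat.
apply: ler_sum => d /andP[d0 dN].
rewrite -mulr_sumr [L * _]mulrC -mulrBr !Normc.normcM normcR -[leLHS]mulrA.
rewrite normrM [`|_^-1|]ger0_norm ?invr_ge0//.
apply: (@le_trans _ _ (1 * (d%:R^-1 * `|G d| * ((4 * q)%:R / (N %/ d).+1%:R)))).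
  apply: ler_pM; rewrite ?normc_ge0 ?mulr_ge0 ?normc_ge0 ?invr_ge0//.
    exact: (dchar_norm q_gt1).
  by rewrite ler_wpM2l ?HL// mulr_ge0 ?invr_ge0.
have -> : 1 * (d%:R^-1 * `|G d| * ((4 * q)%:R / (N %/ d).+1%:R)) =
   (4 * q)%:R * (d * (N %/ d).+1)%:R^-1 * `|G d| :> R.
  by rewrite [(d * _)%:R]natrM invfM; ring.
rewrite ler_wpM2r// ler_wpM2l// lef_pV2 ?posrE ?ltr0n ?muln_gt0 ?d0//.
by rewrite ler_nat mulnC ltnW// ltn_ceil.
Qed.

(** With G = [mangoldt] the convolution is ln, bounded by 8 q, and the error is 4 q psi N / N <= 16
    q. *)
Lemma char_mangoldt_L (L : R[i]) :
  (forall N, normc (\sum_(1 <= i < N.+1) chi i * (i%:R^-1)%:C - L)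
     <= (4 * q)%:R / N.+1%:R) ->
  forall N, (0 < N)%N -> normc (L * char_mangoldt chi N) <= (24 * q)%:R.
Proof.
move=> HL N N0; have := char_convolution (mangoldt R) N0 HL.
rewrite -/(char_mangoldt chi N).
have -> : \sum_(1 <= n < N.+1)
    chi n * (n%:R^-1 * \sum_(d <- divisors n) mangoldt R d)%:C =
    \sum_(1 <= n < N.+1) chi n * (n%:R^-1 * lnn n)%:C.
  by apply: eq_big_nat => n /andP[n0 _]; rewrite sum_mangoldt.
have -> : \sum_(1 <= d < N.+1) `|mangoldt R d| = psi R N.
  by apply: eq_bigr => d _; rewrite ger0_norm// mangoldt_ge0.
set S := \sum_(_ <= _ < _) _ => h.
have hS : normc S <= (8 * q)%:R by exact: char_ln_bound.
have hpsi : (4 * q)%:R / N%:R * psi R N <= (16 * q)%:R.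
  apply: (@le_trans _ _ ((4 * q)%:R / N%:R * (4 * N%:R))).
    by rewrite ler_wpM2l ?psi_le// divr_ge0.
  rewrite le_eqVlt; apply/orP; left; apply/eqP.
  by rewrite !natrM; field; rewrite gt_eqF// ltr0n.
have -> : L * char_mangoldt chi N = S + - (S - L * char_mangoldt chi N).
  by rewrite opprB addrC subrK.
apply: le_trans (normcD _ _) _; rewrite normcN.
have -> : (24 * q)%:R = (8 * q)%:R + (16 * q)%:R :> R by rewrite -natrD; congr _%:R; lia.
by apply: lerD => //; apply: le_trans h hpsi.
Qed.

(** Take G d = moebius d * ln (N / d): its divisor sum at n is [mangoldt] plus ln N at n = 1. The |G
    d| sum to at most N ln N - ln (N!) <= N. *)
Lemma char_mangoldt_L0 :
  (forall N, normc (\sum_(1 <= i < N.+1) chi i * (i%:R^-1)%:C)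
     <= (4 * q)%:R / N.+1%:R) ->
  forall N, (0 < N)%N -> normc (char_mangoldt chi N + (lnn N)%:C) <= (4 * q)%:R.
Proof.
move=> HL N N0; pose G d := (moebius d)%:~R * (lnn N - lnn d).
have HL0 K : normc (\sum_(1 <= i < K.+1) chi i * (i%:R^-1)%:C - 0)
    <= (4 * q)%:R / K.+1%:R by rewrite subr0.
have := char_convolution G N0 HL0; rewrite mul0r subr0.
have -> : \sum_(1 <= n < N.+1) chi n * (n%:R^-1 * \sum_(d <- divisors n) G d)%:C =
    char_mangoldt chi N + (lnn N)%:C.
  transitivity (\sum_(1 <= n < N.+1) (chi n * (n%:R^-1 * mangoldt R n)%:C +
      (if n == 1%N then (lnn N)%:C else 0))).
    apply: eq_big_nat => n /andP[n0 _].
    have -> : \sum_(d <- divisors n) G d = (n == 1%N)%:R * lnn N + mangoldt R n.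
      under eq_bigr do rewrite /G mulrBr.
      by rewrite sumrB sum_moebius_ln// -mulr_suml -rmorph_sum/= sum_moebius// opprK rmorph_nat.
    rewrite mulrDr rmorphD/= mulrDr addrC; congr (_ + _).
    case: eqP => [->|_]; first by rewrite (dchar1 chiP) invr1 !mul1r.
    by rewrite mul0r mulr0 mulr0.
  by rewrite big_split/= -[X in _ + X]big_mkcond/= big_nat1_eq (_ : (1 <= 1 < N.+1)%N).
move=> h; apply: le_trans h _.
have N0' : (0 : R) < N%:R by rewrite ltr0n.
rewrite mulrAC ler_pdivrMr// ler_wpM2l//.
have /andP[h _] := lnn_fact_bounds R N.
apply: (@le_trans _ _ (\sum_(1 <= d < N.+1) (lnn N - lnn d))).
  rewrite big_nat [leRHS]big_nat; apply: ler_sum => d /andP[d0 dN].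
  rewrite /G normrM [X in _ * X]ger0_norm; last first.
    by rewrite subr_ge0 ler_ln ?posrE ?ltr0n// ler_nat.
  rewrite ler_piMl//; first by rewrite subr_ge0 ler_ln ?posrE ?ltr0n// ler_nat.
  by rewrite -intr_norm -[leRHS](mulr1z 1) ler_int norm_moebius.
rewrite sumrB sumr_const_nat subn1 -[ln _ *+ _]mulr_natl; lra.
Qed.

(** The second alternative is L(1, chi) = 0; it keeps the rate of convergence for the Lambert
    argument. *)
Lemma char_mangoldt_dichotomy : exists K : R,
  (forall N, (0 < N)%N -> normc (char_mangoldt chi N) <= K) \/
  ((forall N, normc (\sum_(1 <= i < N.+1) chi i * (i%:R^-1)%:C)
     <= (4 * q)%:R / N.+1%:R) /\
   forall N, (0 < N)%N -> normc (char_mangoldt chi N + (lnn N)%:C) <= K).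
Proof.
have [L HL] := char_L1; have [L0|L0] := eqVneq L 0.
  have HL0 N := HL N; rewrite L0 in HL0.
  exists (4 * q)%:R; right; split; first by move=> N; have := HL0 N; rewrite subr0.
  by apply: char_mangoldt_L0 => N; have := HL0 N; rewrite subr0.
have nL : 0 < normc L.
  rewrite lt_neqAle normc_ge0 andbT eq_sym; apply: contra L0 => /eqP h.
  by apply/eqP/Normc.eq0_normc.
exists ((24 * q)%:R / normc L); left => N N0.
by rewrite ler_pdivlMr// mulrC -Normc.normcM char_mangoldt_L.
Qed.

End OneCharacter.

Lemma dchar_sqr chi : dirichlet_character q chi ->
  dirichlet_character q (fun n => chi n ^+ 2).
Proof.
move=> chiP; split.
- by rewrite (dchar1 chiP) expr1n.
- by move=> m n; rewrite (dcharM chiP) exprMn.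
- by move=> n; rewrite (dchar_mod chiP).
- by move=> n /(dchar_ncoprime chiP) ->; rewrite expr0n.
Qed.

Lemma Re_char_mangoldt chi N : Re (char_mangoldt chi N) =
  \sum_(1 <= n < N.+1) Re (chi n) * (n%:R^-1 * mangoldt R n).
Proof. by rewrite /char_mangoldt Re_sum; apply: eq_bigr => n _; exact: Re_scale. Qed.

Lemma Re_char_mangoldt_le chi K N :
  normc (char_mangoldt chi N + (lnn N)%:C) <= K -> Re (char_mangoldt chi N) <= K - lnn N.
Proof.
move=> h; have := le_trans (ler_norm _) (le_trans (Re_le_normc _) h).
by case: (char_mangoldt chi N) => a b /=; lra.
Qed.

(* The 3-4-1 inequality: a zero of L(1, chi) would make
   3 log N - 4 log N + O(1) nonnegative. *)
Lemma complex_char_bounded chi : dirichlet_character q chi ->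
  ~ principal q chi -> ~ principal q (fun n => chi n ^+ 2) ->
  exists K : R, forall N, (0 < N)%N -> normc (char_mangoldt chi N) <= K.
Proof.
move=> chiP np1 np2.
have [K [h|[_ hK]]] := char_mangoldt_dichotomy chiP np1; first by exists K.
exfalso.
have [K2 hK2] : exists K2, forall N, (0 < N)%N ->
    Re (char_mangoldt (fun n => chi n ^+ 2) N) <= K2.
  (* If L(1, chi^2) vanishes too, the sum for chi^2 is K2 - ln N at most, still bounded above. *)
  have [K2 [h|[_ h]]] := char_mangoldt_dichotomy (dchar_sqr chiP) np2.
    exists K2 => N N0; apply: le_trans (h _ N0).
    exact: le_trans (ler_norm _) (Re_le_normc _).
  exists K2 => N N0; apply: le_trans (Re_char_mangoldt_le (h _ N0)) _.
  by rewrite gerBl lnn_ge0.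
have [N N0 HN] := ln_unbounded (12 + 4 * K + K2).
have h1 := Re_char_mangoldt_le (hK _ N0).
have h2 := hK2 _ N0.
have := mertens_mangoldt R N0; rewrite ler_norml => /andP[_ h3].
suff : 0 <= 3 * \sum_(1 <= n < N.+1) n%:R^-1 * mangoldt R n +
   4 * Re (char_mangoldt chi N) + Re (char_mangoldt (fun n => chi n ^+ 2) N).
  lra.
rewrite !Re_char_mangoldt !mulr_sumr -!big_split/=.
apply: sumr_ge0 => n _; set w := _^-1 * _; rewrite [4 * _]mulrA -!mulrDl mulr_ge0//; last first.
  by rewrite /w mulr_ge0 ?invr_ge0 ?mangoldt_ge0.
have [qn|qn] := boolP (coprime q n); last first.
  by rewrite (dchar_ncoprime chiP)// expr0n /=; lra.
have := dchar_norm_coprime q_gt1 chiP qn; case: (chi n) => a b /= ab.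
have ab1 : a ^+ 2 + b ^+ 2 = 1.
  by rewrite -[LHS]sqr_sqrtr ?ab ?expr1n// addr_ge0// sqr_ge0.
(* On the unit circle 3 + 4 a + (a^2 - b^2) = 2 (1 + a)^2. *)
rewrite /= -!expr2; have := sqr_ge0 (1 + a); rewrite !expr2 in ab1 *; nra.
Qed.

Lemma real_char_bounded chi : dirichlet_character q chi ->
  ~ principal q chi -> principal q (fun n => chi n ^+ 2) ->
  exists K : R, forall N, (0 < N)%N -> normc (char_mangoldt chi N) <= K.
Proof.
move=> chiP np1 p2.
have [K [h|[hK _]]] := char_mangoldt_dichotomy chiP np1; first by exists K.
exfalso.
have chi_sign n : [\/ chi n = 0, chi n = 1 | chi n = -1].
  have [qn|/(dchar_ncoprime chiP) ->] := boolP (coprime q n); last by constructor 1.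
  have /eqP := p2 n qn; rewrite sqrf_eq1 => /orP[] /eqP; [by constructor 2|by constructor 3].
have chiR n : chi n = (Re (chi n))%:C.
  by case: (chi_sign n) => ->; apply/eqP; rewrite eq_complex /= ?oppr0 !eqxx.
apply: (@real_character_nonvanishing R (fun n => Re (chi n)) (2 * q)%:R _ _ _ _ (4 * q)%:R).
- by rewrite (dchar1 chiP).
- by move=> m n; rewrite (dcharM chiP) [in LHS](chiR n) Re_scale.
- by move=> n; case: (chi_sign n) => ->; [constructor 1|constructor 2|constructor 3].
- move=> m k; rewrite -Re_sum; apply: le_trans (Re_le_normc _) _.
  exact: dchar_partial_sum.
move=> n; under eq_bigr do rewrite -Re_scale.
by rewrite -Re_sum; apply: le_trans (Re_le_normc _) (hK n).
Qed.

Lemma nonprincipal_char_bounded chi : dirichlet_character q chi ->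
  ~ principal q chi ->
  exists K : R, forall N, (0 < N)%N -> normc (char_mangoldt chi N) <= K.
Proof.
move=> chiP np1; have [p2|np2] := pselect (principal q (fun n => chi n ^+ 2)).
  exact: real_char_bounded.
exact: complex_char_bounded.
Qed.

End CharacterMertens.

(** * Sums of ln p / p in progressions *)

Section MertensProgression.
Local Open Scope complex_scope.
Variables (R : realType) (q a : nat).
Local Notation normc := (@Normc.normc R).
Local Notation lnn n := (ln (n%:R : R)).

Lemma sum_ln_primes_bound N :
  (0 < N)%N -> `|\sum_(1 <= p < N.+1 | prime p) lnn p / p%:R - lnn N| <= 6.
Proof.
move=> N0; have h1 := mertens_mangoldt R N0.
have h2 := @mangoldt_primes R (fun=> 1) N _.
have {}h2 := h2 (fun _ => ltac:(by rewrite normr1)).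
rewrite (eq_bigr (fun n => n%:R^-1 * mangoldt R n)) in h2; last first.
  by move=> n _; rewrite mul1r.
rewrite [X in _ - X](eq_bigr (fun p => lnn p / p%:R)) in h2; last first.
  by move=> p _; rewrite mul1r.
move: h1 h2; rewrite !ler_norml => /andP[? ?] /andP[? ?]; apply/andP; split; lra.
Qed.

Lemma sum_ln_primes_ncoprime N : (0 < q)%N ->
  \sum_(1 <= p < N.+1 | prime p && ~~ coprime q p) lnn p / p%:R <=
  \sum_(1 <= n < q.+1) lnn n / n%:R.
Proof.
move=> q0; have t0 n : 0 <= lnn n / n%:R by rewrite divr_ge0 ?lnn_ge0.
rewrite big_mkcond/=.
set g := fun n : nat => if prime n && ~~ coprime q n then lnn n / n%:R else 0.
have g0 n : 0 <= g n by rewrite /g; case: ifP.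
apply: (@le_trans _ _ (\sum_(1 <= n < (N + q).+1) g n)).
  rewrite [leRHS](big_cat_nat (n := N.+1))//= ?ltnS ?leq_addr//.
  by rewrite lerDl sumr_ge0.
rewrite (big_cat_nat (n := q.+1))//= ?ltnS ?leq_addl//.
rewrite [X in _ + X]big_nat [X in _ + X]big1 ?addr0; last first.
  move=> p /andP[qp _]; rewrite /g; case: ifP => // /andP[pp].
  by rewrite coprime_sym prime_coprime// negbK => /(dvdn_leq q0); rewrite leqNgt qp.
by apply: ler_sum => n _; rewrite /g; case: ifP.
Qed.

(** The sum for the principal character: the primes left out divide q, so they change it by a
    constant. *)
Lemma coprime_mangoldt_bound : (0 < q)%N -> exists K : R, forall N, (0 < N)%N ->
  `|\sum_(1 <= n < N.+1) (coprime q n)%:R / n%:R * mangoldt R n - lnn N| <= K.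
Proof.
move=> q0; exists (8 + \sum_(1 <= n < q.+1) lnn n / n%:R) => N N0.
have h1 := sum_ln_primes_bound N0.
have h2 := @mangoldt_primes R (fun n => (coprime q n)%:R) N _.
have {}h2 := h2 (fun n => ltac:(by case: coprime; rewrite ?normr1 ?normr0 ?ler01)).
have h3 := sum_ln_primes_ncoprime N q0.
have h4 : 0 <= \sum_(1 <= p < N.+1 | prime p && ~~ coprime q p) lnn p / p%:R.
  by apply: sumr_ge0 => p _; rewrite divr_ge0 ?lnn_ge0.
have E : \sum_(1 <= p < N.+1 | prime p) (coprime q p)%:R * (lnn p / p%:R) =
    \sum_(1 <= p < N.+1 | prime p) lnn p / p%:R -
    \sum_(1 <= p < N.+1 | prime p && ~~ coprime q p) lnn p / p%:R.
  rewrite [X in _ = X - _](bigID (coprime q))/= addrK [RHS]big_mkcondr/=.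
  by apply: eq_bigr => p _; case: coprime; rewrite ?mul1r ?mul0r.
rewrite E in h2; move: h1 h2; rewrite !ler_norml => /andP[? ?] /andP[? ?].
apply/andP; split; lra.
Qed.

Lemma progression_mangoldt_bound : (1 < q)%N -> coprime q a ->
  exists K : R, forall N, (0 < N)%N ->
  `|\sum_(1 <= n < N.+1) (n == a %[mod q])%:R / n%:R * mangoldt R n
    - lnn N / (totient q)%:R| <= K.
Proof.
move=> q1 qa; have q0 := ltnW q1.
have [X [XP Xsum]] := dirichlet_characters R q1.
have Xprinc := dirichlet_characters_principal q1 XP Xsum.
have t0 : (0 : R) < (totient q)%:R by rewrite ltr0n totient_gt0.
(* An inverse of a modulo q, so that [X i b] plays the role of the conjugate of [X i a]. *)
pose b := (a ^ (totient q).-1)%N.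
have ab : (a * b = 1 %[mod q])%N.
  by rewrite -expnS prednK ?totient_gt0// Euler_exp_totient// coprime_sym.
have qb : coprime q b by rewrite coprimeXr.
have Xbn n : coprime q n ->
    \sum_i X i b * X i n = (totient q * (n == a %[mod q]))%:R.
  move=> qn; rewrite (eq_bigr (fun i => X i (b * n)%N)); last first.
    by move=> i _; rewrite (dcharM (XP i)).
  rewrite Xsum ?coprimeMr ?qb//; congr ((_ * nat_of_bool _)%:R).
  apply/eqP/eqP => h.
    by rewrite -[n]mul1n -modnMml -ab modnMml -mulnA -modnMmr h modnMmr muln1.
  by rewrite -modnMmr h modnMmr mulnC.
have [K0 hK0] := coprime_mangoldt_bound q0.
have hi i : exists K, forall N, (0 < N)%N ->
    normc (X i b * char_mangoldt (X i) N - (`[< principal q (X i) >]%:R * lnn N)%:C) <= K.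
  have nX := dchar_norm q1 b (XP i).
  case: asboolP => pX; last first.
    have [K hK] := nonprincipal_char_bounded q1 (XP i) pX.
    exists K => N N0; rewrite mul0r subr0 Normc.normcM -[leRHS]mul1r.
    by apply: ler_pM; rewrite ?normc_ge0 ?hK.
  exists K0 => N N0; rewrite pX// !mul1r.
  suff -> : char_mangoldt (X i) N =
      (\sum_(1 <= n < N.+1) (coprime q n)%:R / n%:R * mangoldt R n)%:C.
    by rewrite -rmorphB normcR hK0.
  rewrite rmorph_sum/=; apply: eq_bigr => n _.
  have [qn|qn] := boolP (coprime q n); first by rewrite pX// !mul1r.
  by rewrite (dchar_ncoprime (XP i))// !mul0r.
have [K hK] := choice hi.
exists ((totient q)%:R^-1 * \sum_i K i) => N N0.
set A := \sum_(_ <= _ < _) _.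
have -> : A - lnn N / (totient q)%:R =
    (totient q)%:R^-1 * ((totient q)%:R * A - lnn N).
  by field; rewrite gt_eqF.
rewrite normrM gtr0_norm ?invr_gt0// ler_wpM2l ?invr_ge0 ?(ltW t0)//.
have E : ((totient q)%:R * A - lnn N)%:C = \sum_i (X i b * char_mangoldt (X i) N -
    (`[< principal q (X i) >]%:R * lnn N)%:C).
  rewrite sumrB -rmorph_sum/= -mulr_suml Xprinc mul1r rmorphB/=; congr (_ - _).
  rewrite /A mulr_sumr rmorph_sum/=.
  transitivity (\sum_(1 <= n < N.+1)
      (\sum_i X i b * X i n) * (n%:R^-1 * mangoldt R n)%:C); last first.
    rewrite (eq_bigr (fun n => \sum_i X i b * (X i n * (n%:R^-1 * mangoldt R n)%:C))).
      by rewrite exchange_big/=; apply: eq_bigr => i _; rewrite /char_mangoldt mulr_sumr.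
    by move=> n _; rewrite mulr_suml; apply: eq_bigr => i _; rewrite mulrA.
  apply: eq_bigr => n _; have [qn|qn] := boolP (coprime q n).
    rewrite Xbn// -(rmorph_nat (real_complex R)) -rmorphM/= natrM.
    by congr (_%:C); ring.
  rewrite big1 ?mul0r; last by move=> i _; rewrite (dchar_ncoprime (XP i) qn) mulr0.
  case: eqP => [E|_]; last by rewrite !mul0r mulr0.
  by move: qn; rewrite -coprime_modr E coprime_modr qa.
rewrite -normcR E; apply: le_trans (normc_sum _ _ _) _.
by apply: ler_sum => i _; exact: hK.
Qed.

Lemma progression_ln_primes_bound : (0 < q)%N -> coprime q a ->
  exists K : R, forall N, (0 < N)%N ->
  `|\sum_(1 <= p < N.+1 | prime p && (p == a %[mod q])) lnn p / p%:R
    - lnn N / (totient q)%:R| <= K.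
Proof.
(* For q = 1 the congruence is void and the sum runs over all primes. *)
move=> q0 qa; have [q1|q1] := ltnP 1 q; last first.
  have -> : q = 1%N by lia.
  exists 6 => N N0; under eq_bigl do rewrite !modn1 eqxx andbT.
  by rewrite divr1 sum_ln_primes_bound.
have [K hK] := progression_mangoldt_bound q1 qa.
exists (K + 2) => N N0; have {hK} h1 := hK N N0.
have h2 := @mangoldt_primes R (fun n => (n == a %[mod q])%:R) N _.
have {}h2 := h2 (fun n => ltac:(by case: eqP; rewrite ?normr1 ?normr0 ?ler01)).
have E : \sum_(1 <= p < N.+1 | prime p) (p == a %[mod q])%:R * (lnn p / p%:R) =
    \sum_(1 <= p < N.+1 | prime p && (p == a %[mod q])) lnn p / p%:R.
  by rewrite [RHS]big_mkcondr/=; apply: eq_bigr => p _; case: eqP;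
     rewrite ?mul1r ?mul0r.
rewrite E in h2; move: h1 h2; rewrite !ler_norml => /andP[? ?] /andP[? ?].
apply/andP; split; lra.
Qed.

End MertensProgression.

(** * Convergence of the logarithm of the Mertens product *)

Section MertensConstant.
Variable R : realType.
Local Notation lnn n := (ln (n%:R : R)).

Lemma decreasing_bounded_cvg (u : nat -> R) b : (forall n, u n.+1 <= u n) ->
  (forall n, b <= u n) -> exists l : R, u @ \oo --> l.
Proof.
move=> du bu; exists (limn u).
apply: nonincreasing_is_cvgn; first exact/nonincreasing_seqP.
by exists b => _ [n _ <-].
Qed.

Lemma ln_le_sub1 (x : R) : 0 < x -> ln x <= x - 1.
Proof. by move=> x0; rewrite -{1}(subrKC 1 x) le_ln1Dx//; lra. Qed.

(** Both bounds come from ln y <= y - 1, at y = 1 - x and at y = 1 / (1 - x). *)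
Lemma ln_1B_bounds (x : R) : 0 <= x <= 2^-1 ->
  - (2 * x ^+ 2) <= ln (1 - x) + x <= 0.
Proof.
move=> /andP[x0 x1]; have y0 : 0 < 1 - x by lra.
have h1 := ln_le_sub1 y0.
have := @ln_le_sub1 (1 - x)^-1 _; rewrite invr_gt0 => /(_ y0).
rewrite lnV ?posrE// => h2; apply/andP; split; last lra.
have : (1 - x)^-1 - 1 <= x + 2 * x ^+ 2.
  rewrite lerBlDr -[leLHS]mul1r ler_pdivrMr//.
  have : 0 <= x ^+ 2 * (1 - 2 * x) by rewrite mulr_ge0 ?sqr_ge0//; lra.
  by rewrite !expr2; lra.
by lra.
Qed.

Lemma inv_p_le_half p : (1 < p)%N -> 0 <= (p%:R^-1 : R) <= 2^-1.
Proof. by move=> p1; rewrite invr_ge0 ler0n/= lef_pV2 ?posrE ?ltr0n ?ler_nat//; lia. Qed.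

(** The terms lie between - 2 / p^2 and 0, and 1 / n^2 <= 1 / (n - 1) - 1 / n telescopes to the
    lower bound - 2 (1 - 1 / N). *)
Lemma sum_ln_1B_cvg (P : pred nat) : (forall p, P p -> (1 < p)%N) ->
  exists l : R, \sum_(1 <= p < N.+1 | P p) (ln (1 - p%:R^-1) + p%:R^-1) @[N --> \oo] --> l.
Proof.
move=> P1; apply: (@decreasing_bounded_cvg _ (-2)).
  move=> N; rewrite big_mkcond big_nat_recr//= -big_mkcond/= gerDl.
  by case: ifP => // /P1 /inv_p_le_half /ln_1B_bounds /andP[].
move=> N; apply: (@le_trans _ _ (- (2 * (1 - N%:R^-1)))).
  by have : 0 <= N%:R^-1 :> R by [rewrite invr_ge0]; lra.
elim: N => [|[|N] IH]; first by rewrite big_geq// invr0; lra.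
  by rewrite big_mkcond big_nat1; case: ifP => [/P1//|_]; rewrite invr1; lra.
rewrite big_mkcond big_nat_recr//= -big_mkcond/=.
apply: le_trans (lerD IH (lexx _)).
have n1 : (1 : R) <= N.+1%:R by rewrite ler1n.
have h : N.+2%:R^-1 <= N.+1%:R^-1 :> R by rewrite lef_pV2 ?posrE ?ltr0n// ler_nat.
have E : N.+1%:R^-1 - N.+2%:R^-1 = N.+1%:R^-1 * N.+2%:R^-1 :> R.
  by rewrite -[N.+2%:R]natr1; field; rewrite !gt_eqF//; lra.
have y0 : 0 <= N.+2%:R^-1 :> R by rewrite invr_ge0.
have := @inv_p_le_half N.+2.
move: h E y0; set x := N.+1%:R^-1; set y := N.+2%:R^-1 => h E y0 hy.
case: ifP => [/P1 /hy /ln_1B_bounds /andP[h1 _]|_]; last lra.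
have : y ^+ 2 <= x - y by rewrite E expr2 ler_wpM2r.
by lra.
Qed.

(* With a = ln i and b = ln (i + 1), (b - a) / b <= ln (b / a) <= (b - a) / a,
   and the two bounds differ by at most 1 / a - 1 / b. *)
Lemma sum_ln_diff_cvg : exists l : R,
  \sum_(2 <= i < N.+1) (lnn i - lnn i.-1) / lnn i - ln (lnn N) @[N --> \oo] --> l.
Proof.
pose u N := \sum_(2 <= i < N.+1) (lnn i - lnn i.-1) / lnn i - ln (lnn N).
have ln_gt n : 0 < lnn n.+2 by rewrite ln_gt0// ltr1n.
have step N : u N.+3 - u N.+2 = (lnn N.+3 - lnn N.+2) / lnn N.+3 -
    (ln (lnn N.+3) - ln (lnn N.+2)).
  by rewrite /u big_nat_recr//=; ring.
have bd N : - ((lnn N.+2)^-1 - (lnn N.+3)^-1) <= u N.+3 - u N.+2 <= 0.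
  have a0 := ln_gt N; have b0 := ln_gt N.+1.
  have /andP[h1 h2'] := ln_succ_sub R (ltn0Sn N.+1).
  have h3 : N.+2%:R^-1 <= 1 :> R by rewrite invf_le1// ler1n.
  have {h3 h2'} h2 := le_trans h2' h3.
  rewrite step; move: a0 b0 h1 h2; set a := lnn N.+2; set b := lnn N.+3.
  move=> a0 b0 h1 h2.
  have ab0 : 0 < a / b by rewrite divr_gt0.
  have ba0 : 0 < b / a by rewrite divr_gt0.
  have := ln_le_sub1 ab0; have := ln_le_sub1 ba0.
  rewrite !ln_div ?posrE// => l1 l2.
  have e1 : (b - a) / b = 1 - a / b by field; rewrite gt_eqF.
  apply/andP; split; last lra.
  have : (b / a - 1) - (1 - a / b) <= a^-1 - b^-1.
    have -> : (b / a - 1) - (1 - a / b) = (b - a) * (a^-1 - b^-1).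
      by field; rewrite !gt_eqF.
    have h : 0 <= a^-1 - b^-1 by rewrite subr_ge0 lef_pV2 ?posrE//; lra.
    by rewrite ler_piMl.
  lra.
have [||l hl] := @decreasing_bounded_cvg (fun n => u n.+2) (u 2%N - (lnn 2)^-1).
- by move=> n; have /andP[_] := bd n; rewrite subr_le0.
- move=> n; apply: (@le_trans _ _ (u 2%N - ((lnn 2)^-1 - (lnn n.+2)^-1))).
    have : 0 < (lnn n.+2)^-1 by rewrite invr_gt0.
    by lra.
  elim: n => [|n IH]; first by rewrite subrr subr0.
  by have /andP[h _] := bd n; lra.
exists l; rewrite -(cvg_shiftn 2).
by under eq_fun do rewrite addn2.
Qed.

Section Progression.
Variables (q a : nat).
Hypotheses (q_gt0 : (0 < q)%N) (coprime_qa : coprime q a).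
Let inP p := prime p && (p == a %[mod q]).

(** Subtracting (ln n - ln (n - 1)) / phi(q) from the terms ln p / p leaves bounded partial sums, to
    which Dirichlet's test applies with the weight 1 / ln n. *)
Lemma sum_inv_primes_cvg : exists l : R,
  \sum_(1 <= p < N.+1 | inP p) p%:R^-1
    - (\sum_(2 <= i < N.+1) (lnn i - lnn i.-1) / lnn i) / (totient q)%:R
  @[N --> \oo] --> l.
Proof.
have [K hK] := progression_ln_primes_bound R q_gt0 coprime_qa.
have K0 : 0 <= K by apply: le_trans (hK 1%N isT).
pose u n : R := (if inP n then lnn n / n%:R else 0) - (lnn n - lnn n.-1) / (totient q)%:R.
have U k : `|\sum_(0 <= i < k) u i| <= K.
  case: k => [|[|k]]; first by rewrite big_geq// normr0.
    by rewrite big_nat1 /u /inP/= subrr mul0r subrr normr0.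
  rewrite (_ : \sum_(0 <= i < k.+2) u i =
    \sum_(1 <= p < k.+2 | inP p) lnn p / p%:R - lnn k.+1 / (totient q)%:R) ?hK//.
  rewrite big_ltn// {1}/u /inP/= subrr mul0r subrr add0r /u sumrB -big_mkcond/=.
  congr (_ - _); rewrite -mulr_suml big_add1/= telescope_sumr//.
  (* The telescoping sum starts at ln 0, which is 0 by convention. *)
  by rewrite (@ln0 _ 0%:R)// subr0.
have U2 m k : `|\sum_(m <= i < k) u i| <= 2 * K.
  have [mk|/ltnW km] := leqP m k; last by rewrite big_geq// normr0 mulr_ge0.
  have -> : \sum_(m <= i < k) u i = \sum_(0 <= i < k) u i - \sum_(0 <= i < m) u i.
    by rewrite [in RHS](big_cat_nat (n := m))//= [RHS]addrC addKr.
  apply: le_trans (ler_normB _ _) _; have := U k; have := U m; lra.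
have ln_gt n : (2 <= n)%N -> 0 < lnn n by move=> n2; rewrite ln_gt0// ltr1n.
have [i i2|i i2|L HL] := @dirichlet_test R u (fun n => (lnn n)^-1) (2 * K) 2 U2.
- rewrite lef_pV2 ?posrE ?ln_gt//; last exact: leqW.
  by rewrite ler_ln ?posrE ?ltr0n ?ler_nat// (leq_trans _ i2).
- by rewrite invr_ge0 ltW// ln_gt.
exists L; apply/cvgrPdist_le => e e0.
have [N0 N00 hN0] := ln_unbounded (2 * K / e).
near=> N.
have NN : (N0 <= N)%N by near: N; exact: nbhs_infty_ge.
have N2 : (2 <= N)%N by near: N; exact: nbhs_infty_ge.
have -> : \sum_(1 <= p < N.+1 | inP p) p%:R^-1 -
    (\sum_(2 <= i < N.+1) (lnn i - lnn i.-1) / lnn i) / (totient q)%:R =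
   \sum_(2 <= i < N.+1) u i * (lnn i)^-1.
  have -> : \sum_(1 <= p < N.+1 | inP p) p%:R^-1 =
      \sum_(2 <= p < N.+1) (if inP p then p%:R^-1 else 0) :> R.
    by rewrite big_mkcond/= big_ltn ?ltnS ?(ltnW N2)//= add0r.
  rewrite mulr_suml -sumrB.
  apply: eq_big_nat => i /andP[i2 _].
  have l0 := ln_gt i i2; rewrite /u /inP; case: ifP => _; last by ring.
  by field; rewrite !gt_eqF// ?ltr0n ?totient_gt0//; lia.
rewrite distrC; apply: le_trans (HL N.+1 (leqW N2)) _.
have lN : 0 < lnn N.+1 by rewrite ln_gt ?leqW.
rewrite ler_pdivrMr// [leRHS]mulrC -ler_pdivrMr//; apply: le_trans (ltW hN0) _.
by rewrite ler_ln ?posrE ?ltr0n// ler_nat leqW.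
Unshelve. all: by end_near. Qed.

(** Combine three limits: ln (1 - 1/p) against - 1/p, the sum of 1/p against 1 / phi(q) times the
    sum of (ln i - ln (i - 1)) / ln i, and the latter sum against ln (ln N). *)
Lemma ln_mertens_prod_cvg : exists l : R,
  \sum_(1 <= p < N.+1 | inP p) ln (1 - p%:R^-1) + ln (lnn N) / (totient q)%:R
  @[N --> \oo] --> l.
Proof.
have [l1 h1] := @sum_ln_1B_cvg inP (fun p => fun h => prime_gt1 (proj1 (andP h))).
have [l2 h2] := sum_ln_diff_cvg.
have [l3 h3] := sum_inv_primes_cvg.
exists (l1 - l3 - l2 * (totient q)%:R^-1).
have hc : (fun _ : nat => (totient q)%:R^-1 : R) @ \oo --> ((totient q)%:R^-1 : R).
  exact: cvg_cst.
rewrite (_ : (fun N => \sum_(1 <= p < N.+1 | inP p) ln (1 - p%:R^-1) +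
    ln (lnn N) / (totient q)%:R) = (fun N =>
   \sum_(1 <= p < N.+1 | inP p) (ln (1 - p%:R^-1) + p%:R^-1) -
   (\sum_(1 <= p < N.+1 | inP p) p%:R^-1 -
    (\sum_(2 <= i < N.+1) (lnn i - lnn i.-1) / lnn i) / (totient q)%:R) -
   (\sum_(2 <= i < N.+1) (lnn i - lnn i.-1) / lnn i - ln (lnn N)) *
     (totient q)%:R^-1)).
  exact: cvgB (cvgB h1 h3) (cvgM h2 hc).
by apply/funext => N; rewrite big_split/=; ring.
Qed.

End Progression.
End MertensConstant.

(** * Mertens' theorem for arithmetic progressions *)

Section MertensTheorem.
Variables (R : realType) (q a : nat).
Local Notation lnn n := (ln (n%:R : R)).
Local Notation inP p := (prime p && (p == a %[mod q])).

Lemma prime_factor_gt0 p : prime p -> 0 < 1 - p%:R^-1 :> R.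
Proof. by move=> pp; rewrite subr_gt0 invf_lt1 ?ltr0n ?ltr1n ?prime_gt1 ?prime_gt0. Qed.

Lemma prime_factor_le1 p : 1 - p%:R^-1 <= 1 :> R.
Proof. by rewrite gerBl invr_ge0. Qed.

Lemma mertens_prodE (x : R) : mertens_prod q a x =
  \prod_(1 <= p < (Num.truncn x).+1 | inP p) (1 - p%:R^-1).
Proof.
rewrite /mertens_prod -(big_mkord (fun p => inP p) (fun p => 1 - p%:R^-1)).
by rewrite big_mkcond big_ltn//= mul1r -big_mkcond.
Qed.

Lemma mertens_prod_gt0 (x : R) : 0 < mertens_prod q a x.
Proof.
by rewrite mertens_prodE; apply: prodr_gt0 => p /andP[pp _]; exact: prime_factor_gt0.
Qed.

Lemma ln_mertens_prod (x : R) : ln (mertens_prod q a x) =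
  \sum_(1 <= p < (Num.truncn x).+1 | inP p) ln (1 - p%:R^-1).
Proof.
by rewrite mertens_prodE ln_prod// => p /andP[pp _]; exact: prime_factor_gt0.
Qed.

Hypotheses (q_gt0 : (0 < q)%N) (coprime_qa : coprime q a).

(** C is the exponential of the limit along integers. For real x with integer part N, ln x - ln N <=
    1, so ln (ln x) - ln (ln N) <= 1 / ln N. *)
Lemma mertens_progression : exists C : R, 0 < C /\
  mertens_prod q a x / (C / (ln x) `^ (totient q)%:R^-1) @[x --> +oo] --> (1 : R).
Proof.
have [l hl] := ln_mertens_prod_cvg R q_gt0 coprime_qa.
exists (expR l); split; first exact: expR_gt0.
have t0 : (0 : R) < (totient q)%:R by rewrite ltr0n totient_gt0.
have t1 : (totient q)%:R^-1 <= 1 :> R by rewrite invf_le1// ler1n totient_gt0.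
pose s N : R := \sum_(1 <= p < N.+1 | inP p) ln (1 - p%:R^-1) +
  ln (lnn N) / (totient q)%:R.
pose g (x : R) := ln (mertens_prod q a x) + ln (ln x) / (totient q)%:R - l.
have g0 : g x @[x --> +oo] --> 0.
  apply/cvgrPdist_le => e e0; have e2 : 0 < e / 2 by rewrite divr_gt0.
  move/cvgrPdist_le : (hl) => /(_ _ e2)[N1 _ hN1].
  have [N2 N20 hN2] := ln_unbounded (2 / e).
  near=> x.
  have x1 : 1 <= x by near: x; apply: nbhs_pinfty_ge; rewrite num_real.
  have x0 : 0 <= x by lra.
  pose N := Num.truncn x.
  have N1N : (N1 <= N)%N.
    by rewrite truncn_ge_nat//; near: x; apply: nbhs_pinfty_ge; rewrite num_real.
  have N2N : (N2 <= N)%N.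
    by rewrite truncn_ge_nat//; near: x; apply: nbhs_pinfty_ge; rewrite num_real.
  have N0 : (0 < N)%N by exact: leq_trans N2N.
  have /andP[Nx xN] := truncn_itv x0; rewrite -/N in Nx xN.
  have lN : 2 / e < lnn N.
    by apply: lt_le_trans hN2 _; rewrite ler_ln ?posrE ?ltr0n// ler_nat.
  have lN0 : 0 < lnn N by apply: lt_trans lN; rewrite divr_gt0.
  have lx : lnn N <= ln x by rewrite ler_ln ?posrE ?ltr0n//; lra.
  have lx1 : ln x <= lnn N + 1.
    have /andP[_ h] := ln_succ_sub R N0.
    have h2 : N%:R^-1 <= 1 :> R by rewrite invf_le1 ?ltr0n// ler1n.
    have : ln x <= lnn N.+1 by rewrite ler_ln ?posrE ?ltr0n ?ltW//; lra.
    lra.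
  have lx0 : 0 < ln x by lra.
  have d0 : 0 <= ln (ln x) - ln (lnn N) by rewrite subr_ge0 ler_ln ?posrE.
  have d1 : ln (ln x) - ln (lnn N) <= e / 2.
    rewrite -ln_div ?posrE//; apply: le_trans (ln_le_sub1 _) _; first exact: divr_gt0.
    have -> : ln x / lnn N - 1 = (ln x - lnn N) / lnn N by field; rewrite gt_eqF.
    rewrite ler_pdivrMr//; rewrite ltr_pdivrMr// in lN; lra.
  have d2 : (ln (ln x) - ln (lnn N)) / (totient q)%:R <= ln (ln x) - ln (lnn N).
    by rewrite ler_piMr.
  have d3 : 0 <= (ln (ln x) - ln (lnn N)) / (totient q)%:R by rewrite divr_ge0// ltW.
  have hs := hN1 _ N1N; rewrite /= -/(s N) in hs.
  have -> : 0 - g x = (l - s N) - (ln (ln x) - ln (lnn N)) / (totient q)%:R.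
    by rewrite /g /s ln_mertens_prod -/N; ring.
  by apply: le_trans (ler_normB _ _) _; rewrite (ger0_norm d3); lra.
have : expR (g x) @[x --> +oo] --> (1 : R).
  by rewrite -expR0; apply: continuous_cvg => //; exact: continuous_expR.
apply: cvg_trans; apply: near_eq_cvg; near=> x.
have x1 : 1 < x by near: x; apply: nbhs_pinfty_gt; rewrite num_real.
have lx0 : 0 < ln x by rewrite ln_gt0.
rewrite /g expRB expRD lnK ?posrE ?mertens_prod_gt0//.
rewrite /powR gt_eqF// mulrC [_ * ln (ln x)]mulrC; field.
by rewrite !gt_eqF ?expR_gt0.
Unshelve. all: by end_near. Qed.

Lemma C_constP : 0 < C_const R q a /\
  mertens_prod q a x / (C_const R q a / (ln x) `^ (totient q)%:R^-1)
    @[x --> +oo] --> (1 : R).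
Proof.
have [C hC] := mertens_progression; rewrite /C_const.
by case: xgetP => [x _ []//|/(_ C)].
Qed.

End MertensTheorem.

(** * The totient quotient and the large prime factors *)

Section TotientQuotient.
Variable R : realType.
Local Notation lnn n := (ln (n%:R : R)).

Lemma totient_prod n : (0 < n)%N ->
  (totient n)%:R = n%:R * \prod_(p <- primes n) (1 - p%:R^-1) :> R.
Proof.
move=> n0.
have En : n = (\prod_(p <- primes n) p ^ logn p n)%N.
  by rewrite {1}[n]prod_prime_decomp// prime_decompE big_map.
rewrite totientE// [X in X%:R * _]En !natr_prod -big_split/= big_seq [RHS]big_seq; apply: eq_bigr => p.
rewrite -logn_gt0 => l0; have pp : prime p.
  by move: l0; rewrite logn_gt0 mem_primes => /andP[].
have p0 : p%:R != 0 :> R by rewrite pnatr_eq0 -lt0n prime_gt0.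
rewrite -{2}(prednK l0) natrM !natrX exprS.
have -> : p.-1%:R = p%:R - 1 :> R by rewrite -[in RHS](prednK (prime_gt0 pp)) -natr1 addrK.
by field.
Qed.

Lemma sum_ln_primes_le n : (0 < n)%N -> \sum_(p <- primes n) lnn p <= lnn n.
Proof.
move=> n0; rewrite [X in _ <= ln X%:R]prod_prime_decomp// prime_decompE big_map/=.
rewrite natr_prod big_seq [X in _ <= ln X]big_seq ln_prod; last first.
  by move=> p /[!mem_primes]/andP[pp _]; rewrite ltr0n expn_gt0 prime_gt0.
apply: ler_sum => p; rewrite -logn_gt0 => l0.
have p0 : (0 < p)%N by move: l0; rewrite logn_gt0 mem_primes => /andP[/prime_gt0].
rewrite natrX lnXn ?ltr0n// -[leLHS]mulr1n.
by rewrite ler_wpMn2l// lnn_ge0.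
Qed.

(** Weierstrass's product inequality; the induction also carries that the product lies in [0, 1]. *)
Lemma prodr_1B_ge (I : Type) (r : seq I) (P : pred I) (x : I -> R) :
  (forall i, P i -> 0 <= x i <= 1) ->
  1 - \sum_(i <- r | P i) x i <= \prod_(i <- r | P i) (1 - x i).
Proof.
move=> x01.
suff [//] : 1 - \sum_(i <- r | P i) x i <= \prod_(i <- r | P i) (1 - x i) /\
   0 <= \prod_(i <- r | P i) (1 - x i) <= 1.
apply: (big_rec2 (fun s p => 1 - s <= p /\ 0 <= p <= 1)); first by rewrite subr0 lexx ler01.
move=> i s p /x01 /andP[x0 x1] [h /andP[p0 p1]]; split; first nra.
by apply/andP; split; nra.
Qed.

Variables (q a : nat).
Local Notation inP p := (prime p && (p == a %[mod q])).

(* The primes above ln n contribute a factor at least 1 - 1 / ln (ln n): each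
   is at most 1 / ln n, and they are at most ln n / ln (ln n) in number. *)
Lemma prod_primes_ge n : S_set q a n -> 1 <= ln (lnn n) ->
  mertens_prod q a (lnn n) * (1 - (ln (lnn n))^-1) <=
  \prod_(p <- primes n) (1 - p%:R^-1).
Proof.
move=> [n0 Sn]; set y := lnn n => ly1.
have ly0 : 0 < ln y by lra.
have y1 : 1 < y by rewrite ltNge; apply/negP => /ln_le0; lra.
have y0 : 0 < y by lra.
rewrite mertens_prodE; set Y := Num.truncn y.
have /andP[_ yY] : Y%:R <= y < Y.+1%:R by apply: truncn_itv; lra.
have f0 p : prime p -> 0 <= 1 - p%:R^-1 :> R by move=> pp; rewrite ltW// prime_factor_gt0.
have small0 : 0 <= \prod_(p <- primes n | (p <= Y)%N) (1 - p%:R^-1) :> R.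
  rewrite big_seq_cond; apply: prodr_ge0 => p /andP[].
  by rewrite mem_primes => /andP[pp _] _; exact: f0.
have small : \prod_(1 <= p < Y.+1 | inP p) (1 - p%:R^-1) <=
    \prod_(p <- primes n | (p <= Y)%N) (1 - p%:R^-1) :> R.
  rewrite (bigID (fun p => p %| n)%N)/=.
  have -> : \prod_(1 <= p < Y.+1 | inP p && (p %| n)%N) (1 - p%:R^-1) =
      \prod_(p <- primes n | (p <= Y)%N) (1 - p%:R^-1) :> R.
    rewrite -big_filter -[RHS]big_filter; apply: perm_big.
    apply: uniq_perm; rewrite ?filter_uniq ?iota_uniq ?primes_uniq// => p.
    rewrite !mem_filter mem_index_iota mem_primes n0/= ltnS.
    case: (boolP (prime p)) => pp/=; last by rewrite andbF.
    case: (boolP (p %| n)%N) => pn; last by rewrite !andbF.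
    by rewrite (Sn p)// eqxx prime_gt0//= andbT.
  apply: ler_piMr => //.
  apply: prodr_ile1 => p /andP[/andP[pp _] _].
  by rewrite f0// prime_factor_le1.
have large : 1 - (ln y)^-1 <= \prod_(p <- primes n | ~~ (p <= Y)%N) (1 - p%:R^-1).
  rewrite big_seq_cond; apply: le_trans (prodr_1B_ge _ _); last first.
    move=> p /andP[]; rewrite mem_primes => /andP[pp _] _.
    by rewrite invr_ge0 ler0n/= invf_le1 ?ltr0n ?ler1n prime_gt0.
  rewrite lerD2l lerN2.
  (* For p >= y, 1/p is at most 1/y, and the weight ln p / ln y >= 1 turns the count of large primes
     into a sum of ln p, at most ln n = y. *)
  apply: (@le_trans _ _ (\sum_(p <- primes n) lnn p / (y * ln y))); last first.
    rewrite -mulr_suml ler_pdivrMr ?mulr_gt0// mulrCA mulVf ?mulr1 ?gt_eqF//.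
    exact: sum_ln_primes_le.
  rewrite [leLHS]big_mkcond/= big_seq [leRHS]big_seq; apply: ler_sum => p pn.
  have T0 : 0 <= lnn p / (y * ln y) by rewrite divr_ge0 ?lnn_ge0 ?ltW ?mulr_gt0.
  rewrite pn/=; case: leqP => //= Yp.
  have py : y <= p%:R by apply: le_trans (ltW yY) _; rewrite ler_nat.
  have p0 : 0 < p%:R :> R by lra.
  rewrite -[p%:R^-1]mulr1 invfM mulrCA; apply: ler_pM; rewrite ?invr_ge0 ?ler0n ?ler01//.
    by rewrite lef_pV2 ?posrE.
  by rewrite ler_pdivlMr// mul1r ler_ln ?posrE.
rewrite [leRHS](bigID (fun p => p <= Y)%N)/=.
apply: le_trans (ler_wpM2l small0 large).
by rewrite ler_wpM2r// subr_ge0 invf_le1.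
Qed.

End TotientQuotient.

(** * The two bounds for the limit superior *)

Section LimsupBounds.
Variables (R : realType) (q a : nat).
Hypotheses (q_gt0 : (0 < q)%N) (coprime_qa : coprime q a).
Local Notation lnn n := (ln (n%:R : R)).
Local Notation inP p := (prime p && (p == a %[mod q])).
Local Notation e := ((totient q)%:R^-1 : R).
Local Notation C := (C_const R q a).
Let g n : R := n%:R / ((totient n)%:R * (ln ((totient q)%:R * lnn n)) `^ e).

Let t1 : (1 : R) <= (totient q)%:R.
Proof. by rewrite ler1n totient_gt0. Qed.

Let e01 : 0 < e <= 1.
Proof. by rewrite invr_gt0 invf_le1 ?(lt_le_trans ltr01)//= t1. Qed.

Let C_gt0 : 0 < C. Proof. by case: (C_constP R q_gt0 coprime_qa). Qed.

Lemma mertens_ratio_near (d : R) : 0 < d -> exists X : R, forall x, X <= x ->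
  C * (1 - d) <= mertens_prod q a x * (ln x) `^ e <= C * (1 + d).
Proof.
move=> d0; have [_ /cvgrPdist_le/(_ _ d0)[X [_ hX]]] := C_constP R q_gt0 coprime_qa.
exists (X + 1) => x Xx; have {hX} := hX x ltac:(lra); rewrite /= invf_div mulrA.
rewrite ler_norml => /andP[h1 h2].
set m := mertens_prod q a x * _ in h1 h2 *.
have Em : m = C * (m / C) by field; rewrite gt_eqF.
by rewrite Em !ler_pM2l//; apply/andP; split; lra.
Qed.

Lemma limsup_upper (c : R) : C^-1 < c -> exists N, forall n, (N <= n)%N ->
  S_set q a n -> g n <= c.
Proof.
move=> cC; have c0 : 0 < c by apply: lt_trans cC; rewrite invr_gt0.
(* Chosen so that 1/c = C (1 - 2 d) <= C (1 - d)^2: one factor 1 - d pays for the Mertens ratio, the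
   other for the large primes, once ln (ln n) > 1/d. *)
pose d := (1 - (C * c)^-1) / 2.
have Cc : 1 < C * c by rewrite -ltr_pdivrMl// mulr1.
have Cc1 : (C * c)^-1 < 1 by rewrite invf_lt1// mulr_gt0.
have Cc0 : 0 < (C * c)^-1 by rewrite invr_gt0 mulr_gt0.
have d0 : 0 < d by rewrite /d; lra.
have [X hX] := mertens_ratio_near d0.
have [N N0 hN] := ln_unbounded (Num.max X (expR (Num.max 1 d^-1))).
exists N => n Nn Sn; have n0 : (0 < n)%N := leq_trans N0 Nn.
have : Num.max X (expR (Num.max 1 d^-1)) < lnn n.
  by apply: lt_le_trans hN _; rewrite ler_ln ?posrE ?ltr0n// ler_nat.
rewrite gt_max; set y := lnn n => /andP[Xy ey].
have y0 : 0 < y by apply: lt_trans ey; exact: expR_gt0.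
have : Num.max 1 d^-1 < ln y by rewrite -ltr_expR lnK ?posrE.
rewrite gt_max => /andP[ly1 lyd].
have ly0 : 0 < ln y by lra.
have yd : (ln y)^-1 < d by rewrite invf_plt ?posrE.
have hp := prod_primes_ge Sn (ltW ly1).
have /andP[hr _] := hX y (ltW Xy).
rewrite -/y in hp; have P0 := mertens_prod_gt0 q a y.
have d1 : d < 1 by rewrite /d; lra.
have L0 : 0 < ln y `^ e by rewrite powR_gt0.
(* As [totient q >= 1], the inner factor only enlarges the denominator. *)
have ly_le : ln y <= ln ((totient q)%:R * y).
  rewrite ler_ln ?posrE ?mulr_gt0 ?(lt_le_trans ltr01 t1)//.
  by apply: ler_peMl t1; exact: ltW.
have D_ge : ln y `^ e <= ln ((totient q)%:R * y) `^ e.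
  apply: ge0_ler_powR => //; rewrite nnegrE ltW//.
  exact: lt_le_trans ly0 ly_le.
have D0 := lt_le_trans L0 D_ge.
rewrite /g totient_prod// -/y; set Pi := \prod_(_ <- _) _ in hp *.
have w0 : 0 < 1 - (ln y)^-1 by lra.
have Pi0 : 0 < Pi by apply: lt_le_trans hp; rewrite mulr_gt0.
have n0' : (0 : R) < n%:R by rewrite ltr0n.
rewrite -mulrA invfM mulrA divff ?mul1r ?gt_eqF//.
rewrite -[c]invrK lef_pV2 ?posrE ?invr_gt0 ?mulr_gt0//.
apply: le_trans (ler_pM (ltW _) (ltW L0) hp D_ge); last by rewrite mulr_gt0.
rewrite mulrAC; apply: (@le_trans _ _ (C * (1 - d) * (1 - d))); last first.
  apply: ler_pM => //; rewrite ?mulr_ge0 ?(ltW C_gt0)//; lra.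
have -> : c^-1 = C * (1 - 2 * d) by rewrite /d; field; rewrite !gt_eqF.
by rewrite -mulrA ler_pM2l//; have := sqr_ge0 d; rewrite expr2; lra.
Qed.

Let nX X := (\prod_(1 <= p < X.+1 | inP p) p)%N.

Lemma progression_primorial_gt0 X : (0 < nX X)%N.
Proof. by apply: prodn_cond_gt0 => p /andP[/prime_gt0]. Qed.

Lemma mem_primes_primorial X p : (p \in primes (nX X)) = (0 < p < X.+1)%N && inP p.
Proof.
rewrite mem_primes progression_primorial_gt0/=.
apply/andP/andP => [[pp]|[pX /andP[pp pa]]].
  rewrite /nX Euclid_dvd_prod// big_has_cond => /hasP[r].
  rewrite mem_index_iota => rX /andP[/andP[rp ra]].
  by rewrite dvdn_prime2// => /eqP ->; rewrite rX rp ra.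
split => //; rewrite /nX -big_filter (big_rem p)/= ?dvdn_mulr//.
by rewrite mem_filter pp pa mem_index_iota.
Qed.

Lemma primorial_S_set X : S_set q a (nX X).
Proof.
split; first exact: progression_primorial_gt0.
move=> p pp pn; have : p \in primes (nX X).
  by rewrite mem_primes pp progression_primorial_gt0.
by rewrite mem_primes_primorial => /andP[_ /andP[_ /eqP]].
Qed.

Lemma prod_primes_primorial X :
  \prod_(p <- primes (nX X)) (1 - p%:R^-1) = mertens_prod q a (X%:R : R).
Proof.
rewrite mertens_prodE natrK -[RHS]big_filter; apply: perm_big.
apply: uniq_perm; rewrite ?filter_uniq ?iota_uniq ?primes_uniq// => p.
by rewrite mem_primes_primorial mem_filter mem_index_iota andbC.
Qed.

Lemma ln_primorial X : lnn (nX X) = \sum_(1 <= p < X.+1 | inP p) lnn p.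
Proof.
by rewrite /nX natr_prod ln_prod// => p /andP[/prime_gt0]; rewrite ltr0n.
Qed.

(** Keep in [psi X] only the first powers of the primes in the progression. *)
Lemma ln_primorial_le X : lnn (nX X) <= 4 * X%:R.
Proof.
apply: le_trans (psi_le R X); rewrite ln_primorial /psi.
rewrite [leRHS](eq_bigr (fun n => 1 * mangoldt R n)); last by move=> n; rewrite mul1r.
rewrite (sum_mangoldt_weight (fun=> 1)).
rewrite big_mkcondr/= big_nat_cond [leRHS]big_nat_cond; apply: ler_sum => p.
move=> /andP[/andP[p0 pX] pp].
rewrite big_ltn_cond ?ltnS; last by rewrite (leq_trans p0).
rewrite expn1 -ltnS pX/= mul1r; case: ifP => _; last first.
  by rewrite addr_ge0 ?lnn_ge0// sumr_ge0// => k _; rewrite lnn_ge0.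
by rewrite lerDl sumr_ge0// => k _; rewrite lnn_ge0.
Qed.

Lemma limsup_lower (c : R) : c < C^-1 -> forall M, exists n,
  [/\ (M <= n)%N, S_set q a n & c <= g n].
Proof.
(* Chosen so that c = (1 - 2 d) / C <= 1 / (C (1 + d)^2): one factor 1 + d pays for the Mertens
   ratio, the other for ln (4 phi(q) X) against ln X. *)
move=> cC M; pose d := (1 - C * c) / 2.
have Cc : C * c < 1 by rewrite -ltr_pdivlMl// mulr1.
have d0 : 0 < d by rewrite /d; lra.
have [Xr hX] := mertens_ratio_near d0.
have [K hK] := progression_ln_primes_bound R q_gt0 coprime_qa.
(* ln X > T forces ln (nX X) >= ln M + 2, as the sum of ln p dominates that of ln p / p; hence
   [nX X] reaches M. *)
pose T := (totient q)%:R * (K + 2 + lnn M) : R.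
have [X X0 hXl] := ln_unbounded (Num.max (Num.max Xr T) (Num.max 1 (ln (4 * (totient q)%:R) / d))).
move: hXl; rewrite !gt_max => /andP[/andP[h1 h2] /andP[h3 h4]].
have X0' : (0 : R) < X%:R by rewrite ltr0n.
have lX0 : 0 < lnn X by lra.
have t0 : (0 : R) < (totient q)%:R by exact: lt_le_trans ltr01 t1.
have theta_ge : lnn M + 2 <= lnn (nX X).
  have := hK X X0; rewrite ler_norml => /andP[h _].
  have : \sum_(1 <= p < X.+1 | inP p) lnn p / p%:R <= lnn (nX X).
    rewrite ln_primorial; apply: ler_sum => p /andP[pp _].
    by rewrite ler_piMr ?lnn_ge0// invf_le1 ?ltr0n ?ler1n prime_gt0.
  move: h2; rewrite /T -ltr_pdivlMl// [_^-1 * _]mulrC; lra.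
have theta1 : 1 < lnn (nX X) by have := lnn_ge0 R M; lra.
exists (nX X); split; [|exact: primorial_S_set|].
  have [->//|M0] := posnP M.
  rewrite -(ler_nat R) -ler_ln ?posrE ?ltr0n ?progression_primorial_gt0//; lra.
have /andP[_ hr] := hX X%:R ltac:(have := ln_sublinear X0'; lra).
have P0 := mertens_prod_gt0 q a (X%:R : R).
have lt0 : 0 < ln ((totient q)%:R * lnn (nX X)).
  rewrite ln_gt0//; apply: lt_le_trans (theta1) _; rewrite ler_peMl//; lra.
have lt_le : ln ((totient q)%:R * lnn (nX X)) <= (1 + d) * lnn X.
  apply: (@le_trans _ _ (ln (4 * (totient q)%:R * X%:R))).
    rewrite ler_ln ?posrE ?mulr_gt0//; last lra.
    by rewrite [4 * _]mulrC -mulrA ler_pM2l// ln_primorial_le.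
  rewrite lnM ?posrE ?mulr_gt0//; rewrite ltr_pdivrMr// in h4; lra.
have D_le : ln ((totient q)%:R * lnn (nX X)) `^ e <= (1 + d) * (lnn X `^ e).
  have /andP[e0 e1] := e01.
  apply: (@le_trans _ _ (((1 + d) * lnn X) `^ e)).
    apply: ge0_ler_powR; rewrite ?nnegrE ?(ltW e0)// ltW//.
    by rewrite mulr_gt0//; lra.
  rewrite powRM ?(ltW lX0)//; last lra.
  by rewrite ler_wpM2r ?powR_ge0// ler1_powR//; lra.
have D0 : 0 < ln ((totient q)%:R * lnn (nX X)) `^ e by rewrite powR_gt0.
rewrite /g totient_prod ?progression_primorial_gt0// prod_primes_primorial.
have n0' : (0 : R) < (nX X)%:R by rewrite ltr0n progression_primorial_gt0.
rewrite -[_ * _ * _]mulrA invfM mulrA divff ?mul1r ?gt_eqF//.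
set P := mertens_prod _ _ _ in hr P0 *; set D := _ `^ _ in D_le D0 *.
have PD : P * D <= C * ((1 + d) * (1 + d)).
  apply: (@le_trans _ _ (P * ((1 + d) * (lnn X `^ e)))); first by rewrite ler_pM2l.
  by rewrite mulrCA [leRHS]mulrA [leRHS]mulrC ler_pM2l//; lra.
have -> : c = C^-1 * (1 - 2 * d) by rewrite /d; field; rewrite gt_eqF.
apply: (@le_trans _ _ (C * ((1 + d) * (1 + d)))^-1); last first.
  by rewrite lef_pV2 ?posrE ?mulr_gt0//; lra.
rewrite invfM ler_pM2l ?invr_gt0//.
rewrite -[leRHS]mul1r ler_pdivlMr ?mulr_gt0//; [nra|lra..].
Qed.

End LimsupBounds.

(** * The limit superior along S *)

Theorem theorem1p9 (R : realType) (q a : nat) (q_gt0 : (0 < q)%N)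
    (coprime_qa : coprime q a) :
  limf_esup
    (fun n : nat =>
       (n%:R / ((totient n)%:R *
          (ln ((totient q)%:R * ln n%:R)) `^ (totient q)%:R^-1) : R)%:E)
    (within (S_set q a) \oo)
  = ((C_const R q a)^-1)%:E.
Proof.
apply/eqP; rewrite eq_le; apply/andP; split.
  apply/lee_addgt0Pr => d d0; rewrite -EFinD.
  have [N hN] := @limsup_upper R q a q_gt0 coprime_qa
    ((C_const R q a)^-1 + d) ltac:(lra).
  (* The limsup is an infimum of suprema over members of the filter; V, where f is already below the
     bound, is one of them. *)
  set f := fun n : nat => _; pose V := [set n | (f n <= ((C_const R q a)^-1 + d)%:E)%E].
  apply: (@le_trans _ _ (ereal_sup (f @` V))).
    apply: ereal_inf_lbound; exists V => //.
    by exists N => // n /= Nn Sn; rewrite /V/= lee_fin; apply: hN.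
  by apply: ge_ereal_sup => _ [n Vn <-].
(* An arbitrary member V contains all n >= M in S for some M, hence a point supplied by the lower
   bound. *)
apply: le_ereal_inf_tmp => _ [V [M _ hM] <-].
apply/lee_addgt0Pr => d d0; rewrite -leeBlDr// -EFinB.
have [n [Mn Sn hn]] := @limsup_lower R q a q_gt0 coprime_qa
  ((C_const R q a)^-1 - d) ltac:(lra) M.
apply: (@le_trans _ _ (n%:R / ((totient n)%:R *
  (ln ((totient q)%:R * ln n%:R)) `^ (totient q)%:R^-1) : R)%:E).
  by rewrite lee_fin.
by apply: ereal_sup_ubound; exists n => //; exact: hM.
Qed.
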